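(* Let $d\ge 2$ and consider independent site percolation on $\mathbb{Z}^d$ with parameter $p$, where $p_c<p<1$. Let $\eta=\eta(p,d)=\lim_{n\to\infty}-n^{-\frac{d-1}{d}}\log\mathbb{P}_p(n\le|\mathcal{C}(0)|<\infty)$, and assume that for every $x\in\mathbb{R}$, $$\lim_{n\to\infty}\frac{\mathbb{P}_p(n+xn^{1/d}\le|\mathcal{C}(0)|<\infty)}{\mathbb{P}_p(n\le|\mathcal{C}(0)|<\infty)}=e^{-x\eta\frac{d-1}{d}}.$$ Then there exists a sequence $u_n\to\infty$ such that for all $x\in\mathbb{R}$, $$\lim_{n\to\infty}\mathbb{P}_p\big(\mathcal{M}_n\le u_n+xu_n^{1/d}\big)=e^{-e^{-x\eta\frac{d-1}{d}}}.$$
   Context: $\Omega=\{0,1\}^{\mathbb{Z}^d}$; under $\mathbb{P}_p$ the coordinates $\omega(x)$, $x\in\mathbb{Z}^d$, are i.i.d. with $\mathbb{P}_p(\omega(x)=1)=p$. A site $x$ is occupied if $\omega(x)=1$ and vacant otherwise. The cluster $\mathcal{C}(x)=\mathcal{C}(x,\omega)$ of an occupied site $x$ is the largest nearest-neighbour connected set of occupied sites containing $x$; $\mathcal{C}(x)=\emptyset$ if $x$ is vacant. The critical value $p_c=p_c(d)\in(0,1)$ is such that a.s. there is no infinite cluster for $p<p_c$ and a.s. there is one for $p>p_c$. The left endpoint of a set is its minimum in the lexicographic order; $\mathcal{C}_{\rm le}(x,\omega)=\mathcal{C}(x,\omega)$ if $x$ is the left endpoint of $\mathcal{C}(x,\omega)$,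 and $\mathcal{C}_{\rm le}(x,\omega)=\emptyset$ otherwise. $B_n=[-n,n]^d\cap\mathbb{Z}^d$; $\omega_{B_n}$ denotes the configuration equal to $\omega$ on $B_n$ and to $0$ off $B_n$. The maximal finite cluster size is $\mathcal{M}_n=\max\{|\mathcal{C}_{\rm le}(x,\omega_{B_n})|:\ x\in B_n,\ |\mathcal{C}(x,\omega)|<\infty\}$ (maximum of the empty set $=0$). The existence of the limit $\eta$, which satisfies $0<\eta<\infty$, is part of the hypotheses (it is known for $d=2,3$). *)

(* Defs.v *)
From HB Require Import structures.
From mathcomp Require Export all_boot all_order all_algebra finmap.
From mathcomp Require Export all_classical all_reals all_analysis.
Export Order.TTheory GRing.Theory Num.Theory.
Export numFieldNormedType.Exports.

Set Implicit Arguments.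
Unset Strict Implicit.
Unset Printing Implicit Defensive.

Local Open Scope classical_set_scope.
Local Open Scope ring_scope.

Notation site d := 'rV[int]_d.

(* The product sigma-algebra on {0,1}^(Z^d); since {0,1} is finite, it is
   generated by the events "x is occupied". *)
Definition cylinders (d : nat) : set (set (site d -> bool)) :=
  [set E : set (site d -> bool) |
     exists x : site d, E = [set w : site d -> bool | w x]].

Definition config (d : nat) := g_sigma_algebraType (@cylinders d).

(* Mutual independence is the product rule over all finite families of sites,
   the event of each site being an arbitrary event of its coordinate. *)
Definition iid_bernoulli (R : realType) (d : nat)
    (P : probability (config d) R) (p : R) : Prop :=
  (forall x : site d, P [set w : config d | w x] = p%:E) /\
  (forall (s : seq (site d)) (A : site d -> set bool), uniq s ->
     P [set w : config d | forall x, x \in s -> A x (w x)] =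
     (\prod_(x <- s) P [set w : config d | A x (w x)])%E).

Definition adj (d : nat) : rel (site d) :=
  fun x y => \sum_(i < d) `|x ord0 i - y ord0 i| == 1.

Definition nn_connected (d : nat) (A : set (site d)) : Prop :=
  forall x y, A x -> A y ->
    exists s : seq (site d),
      [/\ path (@adj d) x s, last x s = y & forall z, z \in s -> A z].

(* The union of all connected sets of occupied sites containing x is the
   largest one; it is empty when x is vacant, as no such set exists. *)
Definition cluster (d : nat) (w : site d -> bool) (x : site d) :
    set (site d) :=
  \bigcup_(A in [set A : set (site d) |
                  [/\ nn_connected A, (forall y, A y -> w y) & A x]]) A.

(* Only meaningful for finite A: fset_set of an infinite set is empty. *)
Definition card_fin (T : choiceType) (A : set T) : nat := #|` fset_set A|%fset.

Definition lexi_le (d : nat) (x y : site d) : bool :=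
  (([tuple x ord0 i | i < d] : d.-tuplelexi int)
     <= ([tuple y ord0 i | i < d] : d.-tuplelexi int))%O.

Definition left_endpoint (d : nat) (A : set (site d)) (x : site d) : Prop :=
  A x /\ forall y, A y -> lexi_le x y.

Definition cluster_le (d : nat) (w : site d -> bool) (x : site d) :
    set (site d) :=
  if `[< left_endpoint (cluster w x) x >] then cluster w x else set0.

Definition box (d n : nat) : set (site d) :=
  [set x | forall i, `|x ord0 i| <= n%:Z].

Arguments box : clear implicits.

(* Needed for fset_set (box d n) below to be the box and not the empty set. *)
Lemma finite_box (d n : nat) : finite_set (box d n).
Proof.
pose f (g : {ffun 'I_d -> 'I_(n + n).+1}) : site d :=
  \row_i ((g i : nat)%:Z - n%:Z).
apply: (sub_finite_set (B := f @` setT)); last first.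
  by apply: finite_image; exact: finite_finset.
move=> x xB.
exists [ffun i => inord (absz (x ord0 i + n%:Z))] => //.
apply/rowP => i; rewrite mxE ffunE.
have /andP[l u] : (- n%:Z <= x ord0 i <= n%:Z) by rewrite -ler_norml; exact: xB.
have e : (absz (x ord0 i + n%:Z))%:Z = x ord0 i + n%:Z.
  by rewrite gez0_abs // -lerBlDr sub0r.
rewrite inordK ?e ?addrK // ltnS.
by rewrite -lez_nat e PoszD lerD2r.
Qed.

Definition restrict_box (d n : nat) (w : site d -> bool) : site d -> bool :=
  fun x => w x && `[< box d n x >].

Definition max_finite_cluster (d n : nat) (w : site d -> bool) : nat :=
  \max_(x <- fset_set (box d n) | `[< finite_set (cluster w x) >])
    card_fin (cluster_le (restrict_box n w) x).

(* The event t <= |C(0)| < oo. *)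
Definition finite_cluster_ge (R : realType) (d : nat) (t : R) :
    set (config d) :=
  [set w | finite_set (cluster w 0) /\ t <= (card_fin (cluster w 0))%:R].

Arguments finite_cluster_ge {R} d t.

Definition has_infinite_cluster (d : nat) (w : site d -> bool) : Prop :=
  exists x, infinite_set (cluster w x).

Definition critical_value (R : realType) (d : nat)
    (P : R -> probability (config d) R) (pc : R) : Prop :=
  [/\ 0 < pc < 1,
      (forall q, 0 <= q -> q < pc ->
         {ae P q, forall w, ~ has_infinite_cluster w}) &
      (forall q, pc < q -> q <= 1 ->
         {ae P q, forall w, has_infinite_cluster w})].

(* Main.v *)
Require Import Defs.
From mathcomp Require Import lra ring zify.

(** The number of left endpoints of clusters of size about [u_n] in the box is
    asymptotically Poisson.  Two facts localize it: at scale
    [u_n ~ (log n)^(d/(d-1))] no finite cluster larger than [4 u_n] meets the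
    box, and the boundary layer of width [4 u_n] is negligible.  The events that
    [x] is the left endpoint of a cluster of size between [k] and [L] then have
    finite range, and removing sites one by one compares the probability that
    none of them occurs with [exp (- q)] to the number of sites.  The error is
    controlled by pairs of nearby large clusters: either their closed
    neighborhoods are disjoint, and independence gives the product bound, or they
    share a boundary site [v], and opening [v] and closing its neighbors outside
    the two clusters, at a bounded cost, merges them into a single finite cluster
    of twice the size, which by the stretched exponential decay is much rarer.
    Mass transport gives [k P(k <= |C(0)|, 0 left endpoint) ~ P(k <= |C(0)|)],
    so that the assumption on the ratio of tails determines the limit of
    [q |B_n|]. *)

Set Implicit Arguments.
Unset Strict Implicit.
Unset Printing Implicit Defensive.

Local Open Scope classical_set_scope.
Local Open Scope ring_scope.

(** * Local events *)

Section Configurations.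
Context {d : nat}.
Implicit Types (w : config d) (s t : seq (site d)) (E F : set (config d)).

(** The mean number of left endpoints of clusters of size at least [m] in the box is about |B_n| P(m
    <= |C(0)| < oo) / m. The tail is known only through its rate and its ratios, so it cannot be
    inverted explicitly; [u_n] is the least [m] for which this mean is at most 1. The mean at [u_n]
    then tends to 1 because, by the ratio assumption, passing from [m] to [m + 1] changes the tail
    by a factor tending to 1. The obstacle is the dependence between nearby sites. Each site has a
    power of [u_n] many others within range, so a pair of clusters must be rarer than a single one
    by more than any power of [u_n]; the factor exp(- kappa u_n^((d-1)/d)) gained by doubling the
    size provides this. The boundary layer has an error of another kind, of order u_n^2 / n, which
    vanishes by the same decay of the tail. Finiteness of a cluster is not a local event, hence the
    upper cutoff on sizes: with it the counted events depend on finitely many sites, and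
    expectations can be handled by conditioning on one site at a time. *)

Definition update w x b : config d := fun z => if z == x then b else w z.

(** One implication is enough, since [w] and [w'] can be exchanged. Probabilities of such events are
    computed by induction on [s]. *)
Definition determined_by s E :=
  forall w w', (forall x, x \in s -> w x = w' x) -> E w -> E w'.

Definition fix_site E x b : set (config d) := [set w | E (update w x b)].

Definition shift (a : site d) w : config d := fun z => w (z + a).

(** The head of the list is applied last and prevails over later entries for the same site;
    [force_bridge] relies on this. *)
Definition force (vs : seq (site d * bool)) w : config d :=
  foldr (fun xb w' => update w' xb.1 xb.2) w vs.

Lemma update_id w x : update w x (w x) = w.
Proof. by apply/funext => z; rewrite /update; case: eqP => [->|]. Qed.

Lemma determined_sub s t E :
  {subset s <= t} -> determined_by s E -> determined_by t E.
Proof. by move=> st sE w w' ww'; apply: sE => x /st /ww'. Qed.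

Lemma determinedI s t E F : determined_by s E -> determined_by t F ->
  determined_by (s ++ t) (E `&` F).
Proof.
move=> sE tF w w' ww' [Ew Fw]; split.
  by apply: sE Ew => x xs; apply: ww'; rewrite mem_cat xs.
by apply: tF Fw => x xt; apply: ww'; rewrite mem_cat xt orbT.
Qed.

Lemma determinedC s E : determined_by s E -> determined_by s (~` E).
Proof. by move=> sE w w' ww' nE E'; apply: nE; apply: sE E' => x /ww'. Qed.

Lemma determined_fix s E x b : determined_by s E ->
  determined_by [seq y <- s | y != x] (fix_site E x b).
Proof.
move=> sE w w' ww'; apply: sE => y ys; rewrite /update.
by case: eqP => // /eqP yx; apply: ww'; rewrite mem_filter yx.
Qed.

Lemma determined_fix_cons s E x b : determined_by (x :: s) E ->
  determined_by s (fix_site E x b).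
Proof.
move=> /(@determined_fix _ _ x b); apply: determined_sub => y.
by rewrite mem_filter inE; case: eqP.
Qed.

Lemma determined_nil E : determined_by [::] E -> E = setT \/ E = set0.
Proof.
move=> sE; have [[w Ew]|nE] := pselect (exists w, E w).
  by left; apply/seteqP; split=> // w' _; apply: sE Ew.
by right; apply/seteqP; split=> // w Ew; apply: nE; exists w.
Qed.

Lemma fix_siteE E x :
  E = ([set w | w x = true] `&` fix_site E x true) `|`
      ([set w | w x = false] `&` fix_site E x false).
Proof.
apply/seteqP; split=> w; last first.
  by case=> -[/= wx]; rewrite /fix_site /= -wx update_id.
by move=> Ew; case wx: (w x); [left|right]; split=> //;
  rewrite /fix_site /= -wx update_id.
Qed.

Lemma measurable_site x b : measurable [set w : config d | w x = b].
Proof.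
have mx : measurable [set w : config d | w x].
  by apply: sub_sigma_algebra; exists x.
case: b; first exact: mx.
have -> : [set w : config d | w x = false] = ~` [set w | w x]; last first.
  exact: measurableC.
by apply/seteqP; split=> w /=; [move=> -> | move/negP/negbTE].
Qed.

Lemma determined_measurable s E : determined_by s E -> measurable E.
Proof.
elim: s E => [|x s IH] E sE.
  by case: (determined_nil sE) => ->; [exact: measurableT|exact: measurable0].
rewrite (fix_siteE E x); apply: measurableU; apply: measurableI;
  by [exact: measurable_site | apply: IH; exact: determined_fix_cons].
Qed.

Lemma determined_shift s E a : determined_by s E ->
  determined_by [seq x + a | x <- s] [set w | E (shift a w)].
Proof.
move=> sE w w' ww'; apply: sE => x xs; apply: ww'.
by apply/mapP; exists x.
Qed.

Lemma fix_site_shift E a x b :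
  fix_site [set w | E (shift a w)] (x + a) b
    = [set w | fix_site E x b (shift a w)].
Proof.
have e w : shift a (update w (x + a) b) = update (shift a w) x b.
  by apply/funext => z; rewrite /shift /update (inj_eq (addIr a)).
by apply/seteqP; split=> w; rewrite /fix_site /= e.
Qed.

Lemma determined_bigI (I : eqType) (r : seq I) (E : I -> set (config d))
    (S : I -> seq (site d)) :
  (forall i, determined_by (S i) (E i)) ->
  determined_by (flatten [seq S i | i <- r])
    [set w | forall i, i \in r -> E i w].
Proof.
move=> SE w w' ww' Ew i ir; apply: SE (Ew i ir) => x xi.
by apply: ww'; apply/flattenP; exists (S i) => //; apply/mapP; exists i.
Qed.

Lemma determined_force s E vs : determined_by s E ->
  determined_by s [set w | E (force vs w)].
Proof.
elim: vs E => [|[x b] vs IH] E sE //; apply: (IH (fix_site E x b)).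
by apply: determined_sub (determined_fix sE) => y; rewrite mem_filter => /andP[].
Qed.

End Configurations.

(** * Real-valued probabilities and union bounds *)

Section Probability.
Context {R : realType} {d : nat} (P : probability (config d) R).
Implicit Types (E F : set (config d)).

Definition prob E : R := fine (P E).

Lemma probE E : measurable E -> P E = (prob E)%:E.
Proof. by move=> mE; rewrite fineK // fin_num_measure. Qed.

Lemma prob_ge0 E : 0 <= prob E.
Proof. exact: fine_ge0. Qed.

Lemma prob_le1 E : measurable E -> prob E <= 1.
Proof. by move=> mE; rewrite -lee_fin -probE // probability_le1. Qed.

Lemma prob_setT : prob setT = 1.
Proof. by rewrite /prob probability_setT. Qed.

Lemma prob_set0 : prob set0 = 0.
Proof. by rewrite /prob measure0. Qed.

Lemma prob_le E F : measurable E -> measurable F -> E `<=` F ->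
  prob E <= prob F.
Proof.
move=> mE mF EF; rewrite -lee_fin -!probE //.
by apply: le_measure; rewrite ?inE.
Qed.

Lemma probU E F : measurable E -> measurable F -> E `&` F = set0 ->
  prob (E `|` F) = prob E + prob F.
Proof.
move=> mE mF EF; apply: EFin_inj; rewrite EFinD -!probE //.
  exact: measureU.
exact: measurableU.
Qed.

Lemma probDI E F : measurable E -> measurable F ->
  prob E = prob (E `&` F) + prob (E `&` ~` F).
Proof.
move=> mE mF; rewrite -probU; last 3 first.
- exact: measurableI.
- by apply: measurableI => //; exact: measurableC.
- by rewrite setIACA setICr setI0.
by rewrite -setIUr setUv setIT.
Qed.

Lemma probU_le E F : measurable E -> measurable F ->
  prob (E `|` F) <= prob E + prob F.
Proof.
move=> mE mF; rewrite (_ : E `|` F = E `|` (F `&` ~` E)); last first.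
  by apply/seteqP; split=> w; [have [] := pselect (E w)|]; rewrite /=; tauto.
have mFE : measurable (F `&` ~` E).
  by apply: measurableI => //; exact: measurableC.
rewrite probU //; last first.
  by apply/seteqP; split=> w //= -[Ew [_ nE]]; exact: nE.
by rewrite lerD2l; apply: prob_le => // w [].
Qed.

Lemma measurable_bigU (I : eqType) (r : seq I) (E : I -> set (config d)) :
  (forall i, measurable (E i)) ->
  measurable [set w | exists2 i, i \in r & E i w].
Proof.
move=> mE; elim: r => [|i r IH].
  have -> : [set w | exists2 i, i \in [::] & E i w] = set0; last first.
    exact: measurable0.
  by apply/seteqP; split=> w // -[].
have -> : [set w | exists2 j, j \in i :: r & E j w]
    = E i `|` [set w | exists2 j, j \in r & E j w]; last first.
  exact: measurableU.
apply/seteqP; split=> w /=.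
  move=> [j]; rewrite inE => /orP[/eqP ->|jr] Ej; first by left.
  by right; exists j.
case=> [Ei|[j jr Ej]]; first by exists i => //; rewrite inE eqxx.
by exists j => //; rewrite inE jr orbT.
Qed.

Lemma prob_bigU_le (I : eqType) (r : seq I) (E : I -> set (config d)) F :
  (forall i, measurable (E i)) -> measurable F ->
  (forall w, F w -> exists2 i, i \in r & E i w) ->
  prob F <= \sum_(i <- r) prob (E i).
Proof.
move=> mE mF FE.
apply: (@le_trans _ _ (prob [set w | exists2 i, i \in r & E i w])).
  by apply: prob_le => //; exact: measurable_bigU.
elim: r {FE} => [|i r IH].
  rewrite big_nil [X in prob X](_ : _ = set0) ?prob_set0 //.
  by apply/seteqP; split=> w // -[].
rewrite big_cons; apply: le_trans (lerD (lexx _) IH).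
apply: le_trans (probU_le _ _) => //; last exact: measurable_bigU.
apply: prob_le; [exact: measurable_bigU| |].
  by apply: measurableU => //; exact: measurable_bigU.
move=> w [j]; rewrite inE => /orP[/eqP ->|jr] Ej; first by left.
by right; exists j.
Qed.

End Probability.

(** * The product measure on finitely many sites *)

Section Bernoulli.
Context {R : realType} {d : nat} (P : probability (config d) R) (p : R)
  (P_iid : iid_bernoulli P p).
Implicit Types (w : config d) (s t : seq (site d)) (E F : set (config d)).

Local Notation Pr := (prob P).
Local Notation weight b := (if b then p else 1 - p).

Lemma prob_site x b : Pr [set w | w x = b] = weight b.
Proof.
have e : Pr [set w | w x = true] = p.
  rewrite /prob [X in P X](_ : _ = [set w : config d | w x]) //.
  by have [-> _] := P_iid.
case: b => //.
have := @probDI _ _ P setT [set w | w x = true] measurableT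
  (@measurable_site _ x true).
rewrite !setTI prob_setT e => ->.
rewrite addrAC subrr add0r; congr Pr.
by apply/seteqP; split=> w /=; case: (w x).
Qed.

Let cylinder s (g : site d -> bool) : set (config d) :=
  [set w | forall x, x \in s -> w x = g x].

Let determined_cylinder s g : determined_by s (cylinder s g).
Proof. by move=> w w' ww' h x xs; rewrite -ww' // h. Qed.

Let measurable_cylinder s g : measurable (cylinder s g).
Proof. exact: determined_measurable (@determined_cylinder s g). Qed.

Let prob_cylinder s g : uniq s ->
  Pr (cylinder s g) = \prod_(x <- s) weight (g x).
Proof.
move=> us; have [_ /(_ s (fun x => [set g x]) us) /= h] := P_iid.
rewrite /prob /cylinder h (eq_bigr (fun x => (weight (g x))%:E)).
  by rewrite prodEFin.
move=> x _; rewrite -(prob_site x) -probE //; exact: measurable_site.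
Qed.

Let prob_fix_siteE x E : measurable E ->
  (forall b, measurable (fix_site E x b)) ->
  Pr E = \sum_(b <- [:: true; false])
           Pr ([set w | w x = b] `&` fix_site E x b).
Proof.
move=> mE mb; rewrite big_cons big_seq1 [in LHS](fix_siteE E x) probU //.
- by apply: measurableI => //; exact: measurable_site.
- by apply: measurableI => //; exact: measurable_site.
- by apply/seteqP; split=> w // -[[/= ->]] _ [].
Qed.

(** The hypothesis on [P] yields the product rule for cylinders. Splitting [E] at [y] moves [y] from
    the range of [E] into the cylinder, until [E] is trivial. *)
Let prob_cylinderI t s g E : uniq (t ++ s) -> determined_by t E ->
  Pr (cylinder s g `&` E) = Pr (cylinder s g) * Pr E.
Proof.
elim: t s g E => [|y t IH] s g E us tE.
  case: (determined_nil tE) => ->; first by rewrite setIT prob_setT mulr1.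
  by rewrite setI0 prob_set0 mulr0.
have mE := determined_measurable tE.
have tEb b : determined_by t (fix_site E y b) by exact: determined_fix_cons.
have mb b : measurable (fix_site E y b) := determined_measurable (tEb b).
have uts : uniq (t ++ y :: s) by rewrite -cat1s uniq_catCA.
have us' : uniq s by move: us; rewrite cat_uniq => /and3P[].
have ys : y \notin s.
  by move: us; rewrite /= mem_cat negb_or => /andP[/andP[_ ->]].
have yt : uniq (t ++ [:: y]).
  by move: uts; rewrite -cat1s catA cat_uniq => /andP[].
(* The induction hypothesis serves twice: here for the cylinder on [y] alone, to recover [Pr E], and
   below for the cylinder on [y :: s]. *)
have step b : Pr ([set w | w y = b] `&` fix_site E y b)
    = weight b * Pr (fix_site E y b).
  have := IH [:: y] (fun=> b) _ yt (tEb b).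
  rewrite prob_cylinder // big_seq1 => <-; congr Pr; congr (_ `&` _).
  apply/seteqP; split=> w /=; last by apply; rewrite inE.
  by move=> h x; rewrite inE => /eqP ->.
rewrite (prob_fix_siteE mE mb) mulr_sumr.
have mC : measurable (cylinder s g `&` E).
  by apply: measurableI => //; exact: measurable_cylinder.
have Cfix b : fix_site (cylinder s g `&` E) y b
    = cylinder s g `&` fix_site E y b.
  apply/seteqP; split=> w [h1 h2]; split=> // x xs; rewrite -h1 // /update;
  by case: eqP => // e; rewrite -e xs in ys.
rewrite (@prob_fix_siteE y) //; last first.
  by move=> b; rewrite Cfix; apply: measurableI => //;
    exact: measurable_cylinder.
apply: eq_bigr => b _; rewrite step Cfix.
pose g' := fun z => if z == y then b else g z.
have -> : [set w | w y = b] `&` (cylinder s g `&` fix_site E y b)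
    = cylinder (y :: s) g' `&` fix_site E y b.
  rewrite setIA; congr (_ `&` _); apply/seteqP; split=> w /=.
    move=> [wy h] x; rewrite inE /g'; case: eqP => [->//|_ /= xs].
    exact: h.
  move=> h; split; first by rewrite h ?inE ?eqxx // /g' eqxx.
  move=> x xs; rewrite h ?inE ?xs ?orbT // /g'.
  by case: eqP => // e; rewrite -e xs in ys.
rewrite (IH _ g' _ uts (tEb b)) !prob_cylinder //= ?ys // big_cons.
rewrite {1}/g' eqxx mulrA; congr (_ * _); rewrite mulrC; congr (_ * _).
rewrite !big_seq; apply: eq_bigr => x xs; rewrite /g'.
by case: eqP => // e; rewrite -e xs in ys.
Qed.

(** The inductions below rest on this conditioning on a single site, which takes the place of
    Fubini's theorem. *)
Lemma prob_split x s E : determined_by s E ->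
  Pr E = p * Pr (fix_site E x true) + (1 - p) * Pr (fix_site E x false).
Proof.
move=> sE; have mE := determined_measurable sE.
have mb b : measurable (fix_site E x b).
  exact: determined_measurable (determined_fix (b := b) sE).
rewrite (prob_fix_siteE mE mb) big_cons big_seq1.
have step b : Pr ([set w | w x = b] `&` fix_site E x b)
    = weight b * Pr (fix_site E x b).
  have sEb : determined_by (undup [seq y <- s | y != x]) (fix_site E x b).
    by apply: determined_sub (determined_fix (b := b) sE) => y;
    rewrite mem_undup.
  rewrite -(@prob_site x b).
  have us : uniq (undup [seq y <- s | y != x] ++ [:: x]).
    by rewrite cat_uniq undup_uniq /= mem_undup mem_filter eqxx.
  have := prob_cylinderI (fun=> b) us sEb.
  rewrite (_ : cylinder _ _ = [set w | w x = b]) //.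
  apply/seteqP; split=> w /=; first by apply; rewrite inE.
  by move=> h y; rewrite inE => /eqP ->.
by rewrite !step.
Qed.

Lemma prob_indep s t E F : determined_by s E -> determined_by t F ->
  (forall x, x \in s -> x \in t -> False) -> Pr (E `&` F) = Pr E * Pr F.
Proof.
elim: s E => [|x s IH] E sE tF st.
  case: (determined_nil sE) => ->; first by rewrite setTI prob_setT mul1r.
  by rewrite set0I prob_set0 mul0r.
have xt : x \notin t by apply/negP => xt; apply: (st x) => //; rewrite inE eqxx.
rewrite (prob_split x (determinedI sE tF)) (prob_split x sE).
have fixF b : fix_site (E `&` F) x b = fix_site E x b `&` F.
  have e w y : y \in t -> w y = update w x b y.
    by rewrite /update; case: eqP => // ->; rewrite (negbTE xt).
  apply/seteqP; split=> w [h1 h2]; split=> //.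
    by apply: (tF _ _ _ h2) => y yt; rewrite -e.
  by apply: (tF _ _ _ h2) => y yt; rewrite -e.
have st' y : y \in s -> y \in t -> False.
  by move=> ys; apply: st; rewrite inE ys orbT.
rewrite !fixF !(IH _ (determined_fix_cons sE) tF st').
by rewrite [RHS]mulrDl !mulrA.
Qed.

(** Splitting at [x] and, after the shift, at [x + a] involves the same weights. *)
Lemma prob_shift a s E : determined_by s E ->
  Pr [set w | E (shift a w)] = Pr E.
Proof.
elim: s E => [|x s IH] E sE.
  by case: (determined_nil sE) => ->.
rewrite (prob_split (x + a) (determined_shift (a := a) sE)).
by rewrite !fix_site_shift !IH -?(prob_split x sE) //;
  exact: determined_fix_cons.
Qed.

Hypothesis p01 : 0 < p < 1.

(** Finite energy: [p * (1 - p)] is below both weights, so prescribing one site costs at most this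
    factor, whatever the prescribed value. *)
Lemma prob_force vs s E : determined_by s E ->
  (p * (1 - p)) ^+ size vs * Pr [set w | E (force vs w)] <= Pr E.
Proof.
have [p0 p1] := andP p01.
have wb b : p * (1 - p) <= weight b by case: b; nra.
elim: vs s E => [|[x b] vs IH] s E sE; first by rewrite expr0 mul1r.
have := IH _ _ (determined_fix (x := x) (b := b) sE).
rewrite /= exprS -mulrA => h.
apply: (@le_trans _ _ (p * (1 - p) * Pr (fix_site E x b))).
  by rewrite ler_wpM2l // mulr_ge0 ?subr_ge0 // ltW.
rewrite (prob_split x sE).
apply: (@le_trans _ _ (weight b * Pr (fix_site E x b))).
  by rewrite ler_wpM2r // prob_ge0.
have q0 : 0 <= 1 - p by rewrite subr_ge0 ltW.
by case: (b); rewrite ?lerDl ?lerDr mulr_ge0 // ?prob_ge0 // ltW.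
Qed.

(** Linearity and monotonicity of expectation for indicators of local events, obtained by averaging
    over one site at a time instead of integrating. *)
Lemma prob_comb_le (I : Type) (r : seq I) (c : I -> R)
    (E : I -> set (config d)) s (v : R) :
  (forall i, determined_by s (E i)) ->
  (forall w, \sum_(i <- r) c i * (`[< E i w >])%:R <= v) ->
  \sum_(i <- r) c i * Pr (E i) <= v.
Proof.
have [p0 p1] := andP p01.
elim: s E => [|x s IH] E sE Ev.
  have := Ev (fun=> true); congr (_ <= _); apply: eq_bigr => i _.
  congr (_ * _); case: (determined_nil (sE i)) => ->.
    by rewrite asboolT // prob_setT.
  by rewrite asboolF // prob_set0.
rewrite (eq_bigr (fun i => p * (c i * Pr (fix_site (E i) x true))
    + (1 - p) * (c i * Pr (fix_site (E i) x false)))); last first.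
  by move=> i _; rewrite (prob_split x (sE i)) mulrDr; congr (_ + _);
    rewrite mulrCA.
rewrite big_split /= -!mulr_sumr.
have h b : \sum_(i <- r) c i * Pr (fix_site (E i) x b) <= v.
  by apply: IH => [i|w]; [exact: determined_fix_cons|exact: Ev].
apply: (@le_trans _ _ (p * v + (1 - p) * v)).
  by rewrite lerD // ler_wpM2l ?subr_ge0 // ltW.
by rewrite -mulrDl addrCA subrr addr0 mul1r.
Qed.

End Bernoulli.

(** * Clusters *)

Section Boxes.
Context {d : nat}.
Implicit Types (x y z : site d) (m n : nat).

Lemma box0 n : box d n 0.
Proof. by move=> i; rewrite mxE normr0. Qed.

Lemma boxD m n x y : box d m x -> box d n y -> box d (m + n) (x + y).
Proof.
move=> xm yn i; rewrite mxE PoszD.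
by apply: le_trans (ler_normD _ _) (lerD (xm i) (yn i)).
Qed.

Lemma boxN n x : box d n x -> box d n (- x).
Proof. by move=> xn i; rewrite mxE normrN. Qed.

Lemma box_le m n x : (m <= n)%N -> box d m x -> box d n x.
Proof. by move=> mn xm i; apply: le_trans (xm i) _; rewrite lez_nat. Qed.

Definition ball_seq x n : seq (site d) :=
  [seq x + z | z <- fset_set (box d n)].

Lemma ball_seqP x n y : y \in ball_seq x n <-> box d n (y - x).
Proof.
split=> [/mapP[z]|yx].
  rewrite in_fset_set; last exact: finite_box.
  by move=> /set_mem zn ->; rewrite addrC addKr.
apply/mapP; exists (y - x); last by rewrite addrC subrK.
by rewrite in_fset_set; [exact: mem_set|exact: finite_box].
Qed.

Lemma ball_seq_uniq x n : uniq (ball_seq x n).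
Proof. by rewrite map_inj_uniq ?fset_uniq //; exact: addrI. Qed.

Lemma card_box n : #|` fset_set (box d n)|%fset = (n.*2.+1 ^ d)%N.
Proof.
pose f (g : {ffun 'I_d -> 'I_n.*2.+1}) : site d :=
  \row_i ((g i : nat)%:Z - n%:Z).
have finj : injective f.
  move=> g h /rowP e; apply/ffunP => i; apply/val_inj.
  by have := e i; rewrite !mxE => /addIr [].
have -> : fset_set (box d n) = [fset f g | g in {ffun 'I_d -> 'I_n.*2.+1}]%fset.
  apply/fsetP => x; rewrite in_fset_set; last exact: finite_box.
  apply/idP/imfsetP => /=; last first.
    move=> [g _ ->]; apply: mem_set => i; rewrite mxE ler_norml.
    by have := ltn_ord (g i); clear; move: (nat_of_ord _) => k; lia.
  move=> /set_mem xn; exists [ffun i => inord (absz (x ord0 i + n%:Z))] => //.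
  apply/rowP => i; rewrite mxE ffunE.
  have := xn i; rewrite ler_norml => /andP[xl xu].
  have e : (absz (x ord0 i + n%:Z))%:Z = x ord0 i + n%:Z.
    by rewrite gez0_abs // -lerBlDr sub0r.
  by rewrite inordK ?e ?addrK // ltnS -lez_nat e -addnn PoszD lerD2r.
rewrite card_imfset //= -[in RHS](card_ord n.*2.+1) -[in RHS](card_ord d).
by rewrite -card_ffun cardE enumT.
Qed.

Lemma size_ball_seq x n : size (ball_seq x n) = (n.*2.+1 ^ d)%N.
Proof. by rewrite size_map -card_box. Qed.

Lemma ball_seq_center x n : x \in ball_seq x n.
Proof. by apply/ball_seqP; rewrite subrr; exact: box0. Qed.

Lemma adj_sym : symmetric (@adj d).
Proof.
by move=> x y; rewrite /adj; congr (_ == _); apply: eq_bigr => i _;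
  rewrite distrC.
Qed.

Lemma adj_box x y : adj x y -> box d 1 (y - x).
Proof.
move=> /eqP xy i; rewrite !mxE distrC (_ : 1%:Z = 1%R) // -xy (bigD1 i) //= lerDl.
exact: sumr_ge0.
Qed.

Lemma adj_shift x y a : adj (x + a) (y + a) = adj x y.
Proof.
rewrite /adj; congr (_ == _); apply: eq_bigr => i _.
by rewrite !mxE opprD addrACA subrr addr0.
Qed.

Lemma path_box x s : path (@adj d) x s -> box d (size s) (last x s - x).
Proof.
elim: s x => [|y s IH] x /=; first by rewrite subrr => _; exact: box0.
move=> /andP[/adj_box xy /IH ys].
by rewrite -(subrK y (last y s)) -addrA -addn1; exact: boxD.
Qed.

Lemma lexi_le_shift x y a : lexi_le (x + a) (y + a) = lexi_le x y.
Proof.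
have e (i : 'I_d) (b : bool) :
    ((x + a) ord0 i <= (y + a) ord0 i ?= iff b)%O
    = (x ord0 i <= y ord0 i ?= iff b)%O :> Prop.
  by rewrite /Order.leif !mxE lerD2r (inj_eq (addIr _)).
by rewrite /lexi_le; apply/lexi_tupleP/lexi_tupleP => -[k h];
  exists k => i ik; have := h i ik; rewrite !tnth_mktuple e.
Qed.

Lemma lexi_le_total : total (@lexi_le d).
Proof. by move=> x y; exact: le_total. Qed.

Lemma lexi_le_trans : transitive (@lexi_le d).
Proof. by move=> x y z; exact: le_trans. Qed.

Lemma lexi_le_anti : antisymmetric (@lexi_le d).
Proof.
move=> x y /le_anti /(congr1 (fun t => tnth t)) e; apply/rowP => i.
by have := congr1 (fun t => t i) e; rewrite !tnth_mktuple.
Qed.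

Lemma left_endpoint_exists (A : set (site d)) x : finite_set A -> A x ->
  exists y, left_endpoint A y.
Proof.
move=> fA Ax.
have key (s : seq (site d)) : s != [::] ->
    exists2 y, y \in s & forall z, z \in s -> lexi_le y z.
  elim: s => // y [|z s] IH _.
    exists y; first by rewrite inE.
    by move=> z; rewrite inE => /eqP ->; case/orP: (lexi_le_total y y).
  have [//|u us uP] := IH.
  case/orP: (lexi_le_total y u) => yu.
    exists y; first by rewrite inE eqxx.
    move=> v; rewrite inE => /orP[/eqP ->|/uP].
      by case/orP: (lexi_le_total y y).
    exact: lexi_le_trans.
  exists u; first by rewrite inE us orbT.
  by move=> v; rewrite inE => /orP[/eqP ->|/uP].
have inA z : (z \in (fset_set A : seq _)) = `[<A z>] by rewrite in_fset_set // inE.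
have [|y] := key (fset_set A : seq _).
  by apply/eqP => e; have := inA x; rewrite asboolT // e.
rewrite inA => /asboolP Ay yP; exists y; split=> // z Az.
by apply: yP; rewrite inA; apply/asboolP.
Qed.

Lemma left_endpoint_uniq (A : set (site d)) x y :
  left_endpoint A x -> left_endpoint A y -> x = y.
Proof.
move=> [Ax xA] [Ay yA]; apply: lexi_le_anti.
by rewrite xA // yA.
Qed.

End Boxes.

(** * Occupied paths and the finite range of cluster events *)

Section Reach.
Context {d : nat}.
Implicit Types (w : site d -> bool) (x y z : site d) (S : set (site d)).

Inductive reach w x : site d -> Prop :=
| reach_refl : w x -> reach w x x
| reach_step y z : reach w x y -> adj y z -> w z -> reach w x z.

Lemma reach_occ w x y : reach w x y -> w y.
Proof. by case. Qed.

Lemma reach_start w x y : reach w x y -> w x.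
Proof. by elim. Qed.

Lemma reach_trans w x y z : reach w x y -> reach w y z -> reach w x z.
Proof.
move=> xy; elim=> // u v _ xu uv wv; exact: reach_step xu uv wv.
Qed.

Lemma reach_sym w x y : reach w x y -> reach w y x.
Proof.
elim=> [wx|u v xu ux uv wv]; first exact: reach_refl.
apply: reach_trans ux; apply: reach_step (reach_refl wv) _ (reach_occ xu).
by rewrite adj_sym.
Qed.

Lemma reach_le w w' x y : (forall z, w z -> w' z) -> reach w x y ->
  reach w' x y.
Proof.
move=> ww'; elim=> [/ww'|u v _ xu uv /ww' wv]; first exact: reach_refl.
exact: reach_step xu uv wv.
Qed.

Lemma path_reach w x s : w x -> path (@adj d) x s ->
  (forall z, z \in s -> w z) -> reach w x (last x s).
Proof.
elim: s x => [|y s IH] x wx /=; first by move=> _ _; exact: reach_refl.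
move=> /andP[xy ys] ws; have wy : w y by apply: ws; rewrite inE eqxx.
apply: (reach_trans (reach_step (reach_refl wx) xy wy)).
by apply: IH => // z zs; apply: ws; rewrite inE zs orbT.
Qed.

Lemma reach_path w x y : reach w x y ->
  exists s, [/\ path (@adj d) x s, last x s = y &
                forall z, z \in s -> reach w x z].
Proof.
elim=> [wx|u v xu [s [ps ls sP]] uv wv]; first by exists [::].
exists (rcons s v); rewrite rcons_path ps last_rcons ls; split=> // z.
rewrite mem_rcons inE => /orP[/eqP ->|/sP //]; exact: reach_step xu uv wv.
Qed.

(** The set of reachable sites is itself connected, so it is one of the sets of the union; it
    contains the others because their connecting paths are occupied. *)
Lemma cluster_reach w x : cluster w x = [set y | reach w x y].
Proof.
apply/seteqP; split=> [y [A [cA Aw Ax] Ay]|y xy] /=.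
  have [s [ps <- sA]] := cA _ _ Ax Ay.
  by apply: path_reach => // [|z /sA]; exact: Aw.
exists [set y | reach w x y] => //; split.
- move=> u v /= xu xv.
  have [s [ps ls sP]] := reach_path (reach_trans (reach_sym xu) xv).
  by exists s; split=> // z /sP; exact: reach_trans.
- by move=> u; exact: reach_occ.
- exact: reach_refl (reach_start xy).
Qed.

Lemma cluster_same w x y : cluster w x y -> cluster w y = cluster w x.
Proof.
rewrite !cluster_reach => xy; apply/seteqP; split=> z /=.
  exact: reach_trans.
by apply: reach_trans; exact: reach_sym.
Qed.

Lemma cluster_self w x y : cluster w x y -> cluster w x x.
Proof. by rewrite !cluster_reach => /reach_start; exact: reach_refl. Qed.

Definition neighborhood S : set (site d) :=
  [set z | S z \/ exists2 y, S y & adj y z].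

Lemma cluster_agree w w' x : w x = w' x ->
  (forall z, neighborhood (cluster w x) z -> w z = w' z) ->
  cluster w' x = cluster w x.
Proof.
rewrite !cluster_reach => wx ww'; apply/seteqP; split=> y /=; elim.
- by rewrite -wx; exact: reach_refl.
- move=> u v _ xu uv wv; apply: (reach_step xu uv).
  by rewrite ww' //; right; exists u.
- by rewrite wx; exact: reach_refl.
- move=> u v xu xu' uv wv; apply: (reach_step xu' uv).
  by rewrite -ww' //; left; exact: reach_step xu uv wv.
Qed.

(** The path from [x] to [y] can be shortened to one without repetition, which has fewer steps than
    the cluster has sites. *)
Lemma cluster_radius w x y L : finite_set (cluster w x) ->
  (card_fin (cluster w x) <= L)%N -> cluster w x y -> box d L (y - x).
Proof.
move=> fC CL Cy; have xC := cluster_self Cy.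
have [s [ps ls sC]] : exists s, [/\ path (@adj d) x s, last x s = y &
    forall z, z \in s -> cluster w x z].
  by move: Cy; rewrite cluster_reach; exact: reach_path.
move: ls; case/shortenP: ps => s' ps' us' ss' <-.
apply: box_le (path_box ps'); apply: leq_trans CL.
apply: (@leq_trans (size (x :: s'))) => //.
apply: uniq_leq_size => // z zs; rewrite in_fset_set //; apply: mem_set.
by move: zs; rewrite inE => /orP[/eqP -> //|/ss']; exact: sC.
Qed.

Lemma neighborhood_radius w x z L : finite_set (cluster w x) ->
  (card_fin (cluster w x) <= L)%N -> neighborhood (cluster w x) z ->
  z \in ball_seq x L.+1.
Proof.
move=> fC CL Cz; apply/ball_seqP.
case: Cz => [/(cluster_radius fC CL)|[y /(cluster_radius fC CL) xy /adj_box yz]].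
  exact: box_le.
by rewrite -(subrK y z) -addrA -add1n; exact: boxD.
Qed.

(** The cutoff [L] makes an arbitrary property [Q] of the cluster depend on finitely many sites. *)
Definition cluster_event x L (Q : set (site d) -> Prop) : set (config d) :=
  [set w | [/\ finite_set (cluster w x), (card_fin (cluster w x) <= L)%N
             & Q (cluster w x)]].

Lemma cluster_event_determined x L Q :
  determined_by (ball_seq x L.+1) (cluster_event x L Q).
Proof.
move=> w w' ww' [fC CL QC]; rewrite /cluster_event /=.
rewrite (@cluster_agree w w') //; first exact: ww' (ball_seq_center _ _).
by move=> z /(neighborhood_radius fC CL) /ww'.
Qed.

Lemma reach_shift w a x y :
  reach (shift a w) x y <-> reach w (x + a) (y + a).
Proof.
have key w' b u v : reach w' u v -> reach (shift (- b) w') (u + b) (v + b).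
  elim=> [w'u|z t uz IH zt w't].
    by apply: reach_refl; rewrite /shift addrK.
  apply: reach_step IH _ _; first by rewrite adj_shift.
  by rewrite /shift addrK.
split=> [/(key _ a)|/(key _ (- a))]; last by rewrite !addrK opprK.
rewrite (_ : shift (- a) (shift a w) = w) //.
by apply/funext => z; rewrite /shift subrK.
Qed.

Lemma cluster_shift w a x :
  cluster (shift a w) x = [set y | cluster w (x + a) (y + a)].
Proof.
apply/seteqP; split=> y; rewrite /= !cluster_reach /= => h.
  exact: (reach_shift _ _ _ _).1 h.
exact: (reach_shift _ _ _ _).2 h.
Qed.

Lemma translate_imageE S a : [set y | S (y + a)] = (fun z => z - a) @` S.
Proof.
apply/seteqP; split=> y /=; first by exists (y + a); rewrite ?addrK.
by case=> z Sz <-; rewrite subrK.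
Qed.

Lemma finite_translate S a :
  finite_set S -> finite_set [set y | S (y + a)].
Proof. by rewrite translate_imageE; exact: finite_image. Qed.

Lemma card_translate S a : finite_set S ->
  card_fin [set y | S (y + a)] = card_fin S.
Proof.
move=> fS; rewrite translate_imageE /card_fin fset_set_image //.
by rewrite card_imfset //; exact: addIr.
Qed.

Lemma finite_translateE S a :
  finite_set [set y | S (y + a)] <-> finite_set S.
Proof.
split; last exact: finite_translate.
move=> /(finite_translate (- a)) /=.
by under eq_set do rewrite subrK.
Qed.

Lemma left_endpoint_translate S a x :
  left_endpoint [set y | S (y + a)] x = left_endpoint S (x + a).
Proof.
apply/propext; split=> -[Sx xS]; split=> // y Sy.
  rewrite -(subrK a y) lexi_le_shift; apply: xS => /=.
  by rewrite subrK.
by rewrite -(lexi_le_shift _ _ a); exact: xS.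
Qed.

Lemma cluster_event_shift x a L (Q Q' : set (site d) -> Prop) :
  (forall S, finite_set S -> Q [set y | S (y + a)] <-> Q' S) ->
  [set w : config d | cluster_event x L Q (shift a w)]
    = cluster_event (x + a) L Q'.
Proof.
move=> QQ'; apply/seteqP; split=> w [];
  rewrite /= ?cluster_shift; last first.
  move=> fC CL QC; rewrite /cluster_event /= cluster_shift; split.
  - exact: finite_translate.
  - by rewrite card_translate.
  - exact/QQ'.
by move=> /finite_translateE fC; rewrite card_translate // => CL /(QQ' _ fC).
Qed.

End Reach.

(** * Poisson approximation for events of finite range *)

Section FiniteRange.
Context {R : realType} {d : nat} (P : probability (config d) R) (p : R)
  (P_iid : iid_bernoulli P p).

Local Notation Pr := (prob P).

Context (A : site d -> set (config d)) (m : nat) (q b : R)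
  (A_det : forall x, determined_by (ball_seq x m) (A x))
  (A_prob : forall x, Pr (A x) = q)
  (b0 : 0 <= b)
  (A_pair : forall x y, x != y -> Pr (A x `&` A y) <= b).

Let none (xs : seq (site d)) : set (config d) := [set w | forall x, x \in xs -> (~` A x) w].

Let K : R := ((m + m).*2.+1 ^ d)%:R.

Let mA x : measurable (A x).
Proof. exact: determined_measurable (@A_det x). Qed.

Let none_det xs : determined_by (flatten [seq ball_seq x m | x <- xs]) (none xs).
Proof. by apply: determined_bigI => x; exact: determinedC. Qed.

Let mnone xs : measurable (none xs).
Proof. exact: determined_measurable (@none_det xs). Qed.

Let q0 : 0 <= q. Proof. by rewrite -(A_prob 0); exact: prob_ge0. Qed.

(* The events at distance more than [2m] from [x] are independent of [A x];
   dropping the near ones costs [#near * q] in the probability of [none], and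
   [#near * b] in that of [A x `&` none]. *)
Let none_cons x xs : x \notin xs -> uniq xs ->
  `|Pr (none (x :: xs)) - (1 - q) * Pr (none xs)| <= K * (b + q ^+ 2).
Proof.
move=> xxs uxs.
pose near := [seq y <- xs | y \in ball_seq x (m + m)].
pose far := [seq y <- xs | y \notin ball_seq x (m + m)].
have near_size : (size near)%:R <= K.
  rewrite /K -(size_ball_seq x) ler_nat; apply: uniq_leq_size.
    exact: filter_uniq.
  by move=> y; rewrite mem_filter => /andP[].
have eQ : Pr (none (x :: xs)) = Pr (none xs) - Pr (A x `&` none xs).
  rewrite (probDI P (mnone xs) (mA x)) [in RHS]setIC addrAC subrr add0r.
  congr Pr; apply/seteqP; split=> w.
    move=> h; split; last by apply: h; rewrite inE eqxx.
    by move=> y yxs; apply: h; rewrite inE yxs orbT.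
  by move=> [h1 h2] y; rewrite inE => /orP[/eqP ->|/h1].
have indep : Pr (A x `&` none far) = q * Pr (none far).
  rewrite -(A_prob x); apply: (prob_indep P_iid (@A_det x) (@none_det far)).
  move=> z /ball_seqP zx /flattenP[_ /mapP[y yfar ->] /ball_seqP zy].
  move: yfar; rewrite mem_filter => /andP[/negP yx _]; apply: yx.
  apply/ball_seqP; rewrite -(subrK z y) -addrA -(opprB z y).
  by apply: boxD => //; exact: boxN.
have sub_far : none xs `<=` none far.
  by move=> w h y; rewrite mem_filter => /andP[_ /h].
have far_le : Pr (none far) <= Pr (none xs) + K * q.
  apply: (@le_trans _ _ (Pr (none xs) + \sum_(y <- near) Pr (A y))).
    (* The index [None] carries the main event and [Some y] those of the near sites, so that a
       single union bound covers both. *)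
    pose E (o : option (site d)) := if o is Some y then A y else none xs.
    have := @prob_bigU_le _ _ P _ (None :: map Some near) E (none far) _
      (mnone far).
    rewrite big_cons big_map /=; apply; first by case=> [y|]; [exact: mA|exact: mnone].
    move=> w hw; have [hn|hn] := pselect (none xs w).
      by exists None => //; rewrite inE.
    have [y [ynear Ay]] : exists y, y \in near /\ A y w.
      apply/not_existsP => h; apply: hn => y yxs.
      case: (boolP (y \in ball_seq x (m + m))) => hy.
        by move=> Ay; apply: (h y); split=> //; rewrite mem_filter hy.
      by apply: hw; rewrite mem_filter hy.
    exists (Some y) => //; rewrite inE /=; apply/mapP; by exists y.
  rewrite lerD2l (eq_bigr (fun=> q)) // big_const_seq count_predT iter_addr_0.
  by rewrite -[q *+ _]mulr_natl ler_wpM2r.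
have far_ge : Pr (none xs) <= Pr (none far) by exact: prob_le.
have mAn ys : measurable (A x `&` none ys) by exact: measurableI.
have up : Pr (A x `&` none xs) <= q * Pr (none far).
  by rewrite -indep; apply: prob_le => // w [? /sub_far].
have low : q * Pr (none far) <= Pr (A x `&` none xs) + (size near)%:R * b.
  rewrite -indep.
  apply: (@le_trans _ _ (Pr (A x `&` none xs)
      + \sum_(y <- near) Pr (A x `&` A y))).
    pose E (o : option (site d)) :=
      if o is Some y then A x `&` A y else A x `&` none xs.
    have := @prob_bigU_le _ _ P _ (None :: map Some near) E (A x `&` none far)
      _ (mAn far).
    rewrite big_cons big_map /=; apply; first by case=> [y|]; [exact: measurableI|exact: mAn].
    move=> w [Ax hw]; have [hn|hn] := pselect (none xs w).
      by exists None => //; rewrite inE.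
    have [y [ynear Ay]] : exists y, y \in near /\ A y w.
      apply/not_existsP => h; apply: hn => y yxs.
      case: (boolP (y \in ball_seq x (m + m))) => hy.
        by move=> Ay; apply: (h y); split=> //; rewrite mem_filter hy.
      by apply: hw; rewrite mem_filter hy.
    by exists (Some y) => //; rewrite inE /=; apply/mapP; exists y.
  rewrite lerD2l; apply: (@le_trans _ _ (\sum_(y <- near) b)).
    rewrite big_seq [leRHS]big_seq; apply: ler_sum => y.
    rewrite mem_filter => /andP[_ yxs]; apply: A_pair.
    by apply: contraNneq xxs => ->.
  by rewrite big_const_seq count_predT iter_addr_0 mulr_natl.
have near_b : (size near)%:R * b <= K * b by exact: ler_wpM2r.
have qfar : q * Pr (none far) <= q * Pr (none xs) + K * q ^+ 2.
  by rewrite expr2 mulrCA -mulrDr ler_wpM2l.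
have qxs : q * Pr (none xs) <= q * Pr (none far) by exact: ler_wpM2l.
have Kb0 : 0 <= K * b by rewrite mulr_ge0 ?ler0n.
have Kq0 : 0 <= K * q ^+ 2 by rewrite mulr_ge0 ?ler0n ?exprn_ge0.
rewrite eQ mulrDr ler_norml; apply/andP; split; nra.
Qed.

(** The recursion of [none_cons] telescopes: replacing its factor [1 - q] by [expR (- q)] costs
    [q ^+ 2], and as the factors [expR (- q)] are at most 1 the errors add up over the sites. *)
Lemma no_event_prob xs : uniq xs ->
  `|Pr [set w | forall x, x \in xs -> ~ A x w] - expR (- q) ^+ size xs|
    <= (size xs)%:R * (((m + m).*2.+1 ^ d)%:R * (b + q ^+ 2) + q ^+ 2).
Proof.
rewrite -/(none xs) -/K; elim: xs => [|x xs IH] /=.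
  move=> _; rewrite (_ : none [::] = setT) ?prob_setT; last first.
    by apply/seteqP; split.
  by rewrite expr0 subrr normr0 mul0r.
move=> /andP[xxs uxs]; have {}IH := IH uxs.
have step := none_cons xxs uxs.
have Q0 := prob_ge0 P (none xs); have Q1 := prob_le1 P (mnone xs).
have e1 : expR (- q) <= 1 by rewrite -expR0 ler_expR oppr_le0.
have e0 := expR_ge0 (- q).
have eq1 : 1 - q <= expR (- q) by exact: expR_ge1Dx.
(* From [1 + q <= expR q] and [(1 - q + q ^+ 2) * (1 + q) = 1 + q ^+ 3]. *)
have eq2 : expR (- q) <= 1 - q + q ^+ 2.
  have := expR_ge1Dx q; rewrite expRN => h.
  have q1 : 0 < 1 + q by rewrite ltr_wpDr.
  apply: (@le_trans _ _ (1 + q)^-1).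
    by rewrite lef_pV2 ?posrE ?expR_gt0.
  rewrite -[leLHS]mul1r ler_pdivrMr //.
  have q3 : 0 <= q ^+ 3 by rewrite exprn_ge0.
  by rewrite (_ : _ * _ = 1 + q ^+ 3) ?lerDl //; ring.
rewrite exprS -natr1 mulrDl mul1r.
rewrite (_ : _ - _ = (Pr (none (x :: xs)) - (1 - q) * Pr (none xs))
  + (((1 - q) - expR (- q)) * Pr (none xs)
     + expR (- q) * (Pr (none xs) - expR (- q) ^+ size xs))); last by ring.
apply: le_trans (ler_normD _ _) _.
have h1 : `|((1 - q) - expR (- q)) * Pr (none xs)| <= q ^+ 2.
  rewrite normrM (ger0_norm Q0) -[leRHS]mulr1 ler_pM //.
  by rewrite ler_norml; apply/andP; split; lra.
have h2 : `|expR (- q) * (Pr (none xs) - expR (- q) ^+ size xs)|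
    <= (size xs)%:R * (K * (b + q ^+ 2) + q ^+ 2).
  by rewrite normrM ger0_norm // -[leRHS]mul1r ler_pM.
apply: le_trans (lerD step (le_trans (ler_normD _ _) (lerD h1 h2))) _.
by rewrite addrA addrC.
Qed.

End FiniteRange.

(** * Mass transport *)

Section ClusterEvents.
Context {d : nat}.
Implicit Types (w : config d) (x y z : site d) (k L : nat).

Definition size_event x k L : set (config d) :=
  cluster_event x L (fun S => (k <= card_fin S)%N).

Definition endpoint_event x k L : set (config d) :=
  cluster_event x L (fun S => (k <= card_fin S)%N /\ left_endpoint S x).

Definition finite_event x k : set (config d) :=
  [set w | finite_set (cluster w x) /\ (k <= card_fin (cluster w x))%N].

Lemma size_event_determined x k L :
  determined_by (ball_seq x L.+1) (size_event x k L).
Proof. exact: cluster_event_determined. Qed.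

Lemma endpoint_event_determined x k L :
  determined_by (ball_seq x L.+1) (endpoint_event x k L).
Proof. exact: cluster_event_determined. Qed.

Lemma measurable_size_event x k L : measurable (size_event x k L).
Proof. exact: determined_measurable (@size_event_determined x k L). Qed.

Lemma measurable_endpoint_event x k L : measurable (endpoint_event x k L).
Proof. exact: determined_measurable (@endpoint_event_determined x k L). Qed.

(** Through this increasing union of local events the tail event inherits measurability and, by
    continuity from below, translation invariance. *)
Lemma finite_eventE x k : finite_event x k = \bigcup_L size_event x k L.
Proof.
apply/seteqP; split=> [w [fC kC]|w [L _ [fC _ kC]]] //.
by exists (card_fin (cluster w x)).
Qed.

Lemma measurable_finite_event x k : measurable (finite_event x k).
Proof.
by rewrite finite_eventE; apply: bigcup_measurable => L _;
  exact: measurable_size_event.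
Qed.

Lemma endpoint_event_shift x k L :
  [set w | endpoint_event 0 k L (shift x w)] = endpoint_event x k L.
Proof.
rewrite -[x in RHS]add0r; apply: cluster_event_shift => S fS.
by rewrite card_translate // left_endpoint_translate.
Qed.

Lemma size_event_shift x k L :
  [set w | size_event 0 k L (shift x w)] = size_event x k L.
Proof.
rewrite -[x in RHS]add0r; apply: cluster_event_shift => S fS.
by rewrite card_translate.
Qed.

Lemma endpoint_sub_size x k L : endpoint_event x k L `<=` size_event x k L.
Proof. by move=> w [fC CL []]. Qed.

Lemma finite_event_split x k L : (k <= L.+1)%N ->
  finite_event x k = size_event x k L `|` finite_event x L.+1.
Proof.
move=> kL; apply/seteqP; split=> w.
  move=> [fC kC]; have [CL|CL] := leqP (card_fin (cluster w x)) L.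
    by left.
  by right.
case=> [[fC _ kC]|[fC LC]]; split=> //; exact: leq_trans LC.
Qed.

Lemma card_fin_count (S : set (site d)) (s : seq (site d)) :
  finite_set S -> uniq s -> (forall z, S z -> z \in s) ->
  card_fin S = count (fun z => `[<S z>]) s.
Proof.
move=> fS us Ss; rewrite -size_filter; apply/perm_size/uniq_perm.
- exact: fset_uniq.
- exact: filter_uniq.
- move=> z; rewrite mem_filter in_fset_set //.
  apply/idP/andP => [/set_mem Sz|[/asboolP Sz _]]; last exact: mem_set.
  by split; [exact/asboolP|exact: Ss].
Qed.

Lemma card_fin_gt0 (S : set (site d)) k : (0 < k)%N -> (k <= card_fin S)%N ->
  exists z, S z.
Proof.
move=> k0 kS; apply: contrapT => no; move: kS; rewrite /card_fin.
have -> : S = set0 by apply/seteqP; split=> // y Sy; case: no; exists y.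
by rewrite fset_set0 cardfs0 leqNgt k0.
Qed.

Lemma card_finU (S T : set (site d)) : finite_set S -> finite_set T ->
  (forall z, S z -> ~ T z) -> card_fin (S `|` T) = (card_fin S + card_fin T)%N.
Proof.
move=> fS fT dST; rewrite /card_fin fset_setU // -cardfsUI.
rewrite -fset_setI // (_ : S `&` T = set0) ?fset_set0 ?cardfs0 ?addn0 //.
by apply/seteqP; split=> // z [/dST].
Qed.

End ClusterEvents.

Section Counting.
Context {R : realType} {d : nat} (P : probability (config d) R) (p : R)
  (P_iid : iid_bernoulli P p) (p01 : 0 < p < 1).

Local Notation Pr := (prob P).

(** First-moment bound: [F] enters the linear combination of [prob_comb_le] under the index [None],
    with coefficient [- c]. *)
Lemma prob_sum_le (I : Type) (r : seq I) (E : I -> set (config d)) F s c :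
  (forall i, determined_by s (E i)) -> determined_by s F ->
  (forall w, \sum_(i <- r) (`[< E i w >])%:R <= c * (`[< F w >])%:R :> R) ->
  \sum_(i <- r) Pr (E i) <= c * Pr F.
Proof.
move=> Es Fs EF.
pose E' o := if o is Some i then E i else F.
pose c' (o : option I) : R := if o is Some i then 1 else - c.
have E's o : determined_by s (E' o) by case: o.
have := @prob_comb_le _ _ _ _ P_iid p01 _ (None :: map Some r) c' E' s 0 E's.
rewrite big_cons big_map /= mulNr addrC subr_le0.
under eq_bigr do rewrite mul1r.
apply=> w; rewrite big_cons big_map /= mulNr addrC subr_le0.
by under eq_bigr do rewrite mul1r; exact: EF.
Qed.

Lemma prob_sum_ge (I : Type) (r : seq I) (E : I -> set (config d)) F s c :
  (forall i, determined_by s (E i)) -> determined_by s F ->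
  (forall w, c * (`[< F w >])%:R <= \sum_(i <- r) (`[< E i w >])%:R :> R) ->
  c * Pr F <= \sum_(i <- r) Pr (E i).
Proof.
move=> Es Fs EF.
pose E' o := if o is Some i then E i else F.
pose c' (o : option I) : R := if o is Some i then - 1 else c.
have E's o : determined_by s (E' o) by case: o.
have := @prob_comb_le _ _ _ _ P_iid p01 _ (None :: map Some r) c' E' s 0 E's.
rewrite big_cons big_map /=.
under eq_bigr do rewrite mulN1r.
rewrite sumrN subr_le0; apply=> w; rewrite big_cons big_map /=.
by under eq_bigr do rewrite mulN1r; rewrite sumrN subr_le0; exact: EF.
Qed.

Lemma sum_asbool_le1 (I : eqType) (r : seq I) (Q : I -> Prop) :
  uniq r -> (forall i j, Q i -> Q j -> i = j) ->
  \sum_(i <- r) (`[< Q i >])%:R <= 1 :> R.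
Proof.
move=> ur Q1; have [[i [ir Qi]]|no] := pselect (exists i, i \in r /\ Q i).
  rewrite (bigD1_seq i) //= big1 ?addr0 ?asboolT // => j ji.
  by rewrite asboolF // => /(Q1 _ _ Qi) ij; rewrite ij eqxx in ji.
rewrite big_seq big1 // => i ir.
by rewrite asboolF // => Qi; apply: no; exists i.
Qed.

Lemma prob_endpoint_event x k L :
  Pr (endpoint_event x k L) = Pr (endpoint_event 0 k L).
Proof.
rewrite -(endpoint_event_shift x).
exact: (prob_shift P_iid x (@endpoint_event_determined d 0 k L)).
Qed.

Lemma prob_size_event x k L :
  Pr (size_event x k L) = Pr (size_event 0 k L).
Proof.
rewrite -(size_event_shift x).
exact: (prob_shift P_iid x (@size_event_determined d 0 k L)).
Qed.

Lemma prob_finite_event x k : Pr (finite_event x k) = Pr (finite_event 0 k).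
Proof.
have cvgP y : (P \o (size_event y k)) L @[L --> \oo] --> P (finite_event y k).
  rewrite finite_eventE; apply: nondecreasing_cvg_mu.
  - exact: measurable_size_event.
  - by rewrite -finite_eventE; exact: measurable_finite_event.
  - move=> L L' LL'; apply/subsetPset => w [fC CL kC]; split=> //.
    exact: leq_trans CL LL'.
congr fine; apply: cvg_unique (@cvgP x) _; first exact: ereal_hausdorff.
rewrite (_ : P \o size_event x k = P \o size_event 0 k); first exact: cvgP.
apply/funext => L /=.
by rewrite !probE ?prob_size_event //; exact: measurable_size_event.
Qed.

Lemma prob_size_eventE x k L : (k <= L.+1)%N ->
  Pr (size_event x k L) = Pr (finite_event 0 k) - Pr (finite_event 0 L.+1).
Proof.
move=> kL; rewrite prob_size_event (finite_event_split 0 kL) probU ?addrK //.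
- exact: measurable_size_event.
- exact: measurable_finite_event.
- by apply/seteqP; split=> w // -[[_ CL _] [_]]; rewrite ltnNge CL.
Qed.

Lemma prob_size_event_le x k L :
  Pr (size_event x k L) <= Pr (finite_event 0 k).
Proof.
rewrite -(prob_finite_event x); apply: prob_le.
- exact: measurable_size_event.
- exact: measurable_finite_event.
- by move=> w [].
Qed.

(* Mass transport: splitting [size_event 0] according to the left endpoint [z]
   of the cluster and translating [z] to the origin, each configuration of
   [endpoint_event 0] is counted once per site of its cluster. *)
Section MassTransport.
Variables k L : nat.
Hypothesis k_gt0 : (0 < k)%N.

Let split_at z : set (config d) :=
  cluster_event 0 L (fun S => (k <= card_fin S)%N /\ left_endpoint S z).

Let moved z : set (config d) := cluster_event 0 L
  (fun S => [/\ (k <= card_fin S)%N, left_endpoint S 0 & S (- z)]).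

Let prob_split_at z : Pr (split_at z) = Pr (moved z).
Proof.
have det := @cluster_event_determined d 0 L
  (fun S => [/\ (k <= card_fin S)%N, left_endpoint S 0 & S (- z)]).
rewrite -(prob_shift P_iid z det); congr Pr.
have -> := @cluster_event_shift d 0 z L _ (fun S =>
  [/\ (k <= card_fin S)%N, left_endpoint S z & S 0]); last first.
  by move=> S fS; rewrite card_translate //= left_endpoint_translate addNr add0r.
(* The shifted event speaks of the cluster of [z]; as this contains [0], it is the cluster of
   [0]. *)
rewrite add0r; apply/seteqP; split=> w [fC CL].
  move=> [kC zC]; have e := cluster_same zC.1; split; rewrite e //.
  by split=> //; exact: cluster_self zC.1.
move=> [kC zC C0]; have e := cluster_same C0; split; rewrite e //.
Qed.

Let moved_count w : endpoint_event 0 k L w ->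
  \sum_(z <- ball_seq 0 L) (`[< moved z w >])%:R
    = (card_fin (cluster w 0))%:R :> R.
Proof.
move=> [fC CL [kC C0]].
have inj : injective (fun z : site d => - z) by exact: oppr_inj.
rewrite (@card_fin_count _ _ [seq - z | z <- ball_seq 0 L]) //.
- rewrite count_map -sum1_count natr_sum [RHS]big_mkcond /=.
  apply: eq_bigr => z _; rewrite [X in nat_of_bool X](_ : _ = `[<cluster w 0 (- z)>]).
    by case: ifP.
  by apply: asbool_equiv_eq; split=> [[_ _ []]|].
- by rewrite map_inj_uniq // ball_seq_uniq.
- move=> z Cz; rewrite -(opprK z) map_f //; apply/ball_seqP.
  by rewrite subr0; apply/boxN; rewrite -[z]subr0; exact: cluster_radius Cz.
Qed.

Lemma endpoint_mass_lower :
  k%:R * Pr (endpoint_event 0 k L) <= Pr (size_event 0 k L).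
Proof.
apply: (@le_trans _ _ (\sum_(z <- ball_seq 0 L) Pr (moved z))).
  apply: (@prob_sum_ge _ _ _ _ (ball_seq 0 L.+1)).
  - by move=> z; exact: cluster_event_determined.
  - exact: endpoint_event_determined.
  - move=> w; have [ew|new] := pselect (endpoint_event 0 k L w); last first.
      by rewrite asboolF // mulr0; exact: sumr_ge0.
    have [fC CL [kC C0]] := ew; rewrite asboolT // mulr1.
    rewrite moved_count // ler_nat.
    by rewrite (leq_trans kC).
under eq_bigr do rewrite -prob_split_at.
rewrite -[leRHS]mul1r; apply: (@prob_sum_le _ _ _ _ (ball_seq 0 L.+1)).
- by move=> z; exact: cluster_event_determined.
- exact: size_event_determined.
- move=> w; have [sw|nsw] := pselect (size_event 0 k L w).
    rewrite asboolT // mulr1; apply: sum_asbool_le1; first exact: ball_seq_uniq.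
    by move=> z z' [_ _ [_ zC]] [_ _ [_ z'C]]; exact: left_endpoint_uniq zC z'C.
  rewrite big1 ?mulr_ge0 // => z _; rewrite asboolF // => -[fC CL [kC _]].
  exact: nsw.
Qed.

(** The loss is the ratio of the cutoff [L] to [k]. The bound is therefore applied with a cutoff
    only slightly above [k], and monotonicity of [endpoint_event] in the cutoff does the rest. *)
Lemma endpoint_mass_upper :
  Pr (size_event 0 k L) <= L%:R * Pr (endpoint_event 0 k L).
Proof.
apply: (@le_trans _ _ (\sum_(z <- ball_seq 0 L) Pr (split_at z))).
  apply: prob_bigU_le.
  - move=> z; apply: determined_measurable.
    exact: (@cluster_event_determined d 0 L).
  - exact: measurable_size_event.
  - move=> w [fC CL kC].
    have [y Cy] := card_fin_gt0 k_gt0 kC.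
    have [z zC] := left_endpoint_exists fC Cy; exists z => //.
    by apply/ball_seqP; apply: cluster_radius zC.1.
under eq_bigr do rewrite prob_split_at.
apply: (@prob_sum_le _ _ _ _ (ball_seq 0 L.+1)).
- by move=> z; exact: cluster_event_determined.
- exact: endpoint_event_determined.
- move=> w; have [ew|new] := pselect (endpoint_event 0 k L w).
    by rewrite moved_count // asboolT // mulr1 ler_nat; case: ew.
  rewrite big1 ?mulr_ge0 // => z _; rewrite asboolF // => -[fC CL [kC zC _]].
  exact: new.
Qed.

End MassTransport.
End Counting.

(** * Pairs of large clusters *)

Section Pairs.
Context {R : realType} {d : nat} (P : probability (config d) R) (p : R)
  (P_iid : iid_bernoulli P p) (p01 : 0 < p < 1).
Variables k L : nat.
Hypothesis k_gt0 : (0 < k)%N.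

Local Notation Pr := (prob P).
Local Notation h j := (Pr (finite_event 0 j)).

(** Neighborhoods rather than clusters have to be disjoint, since knowing a cluster includes knowing
    that its boundary is vacant. *)
Definition disjoint_event (x y : site d) : set (config d) :=
  [set w | [/\ size_event x k L w, size_event y k L w &
    forall z, neighborhood (cluster w x) z -> ~ neighborhood (cluster w y) z]].

Lemma disjoint_event_determined x y :
  determined_by (ball_seq x L.+1 ++ ball_seq y L.+1) (disjoint_event x y).
Proof.
move=> w w' ww' [xw yw dxy].
have agree u : u \in [:: x; y] -> size_event u k L w ->
    cluster w' u = cluster w u.
  move=> uxy [fC CL _].
  have sub z : z \in ball_seq u L.+1 ->
      z \in ball_seq x L.+1 ++ ball_seq y L.+1.
    by rewrite mem_cat; move: uxy; rewrite !inE => /orP[] /eqP -> ->;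
      rewrite ?orbT.
  apply: cluster_agree; first by apply: ww'; apply: sub; exact: ball_seq_center.
  by move=> z zC; apply: ww'; apply: sub; exact: neighborhood_radius zC.
have ex := agree x (mem_head _ _) xw.
have yin : y \in [:: x; y] by rewrite !inE eqxx orbT.
have ey := agree y yin yw.
split; rewrite ?ex ?ey //.
- by apply: (size_event_determined _ xw) => z zx; apply: ww'; rewrite mem_cat zx.
- by apply: (size_event_determined _ yw) => z zy; apply: ww';
    rewrite mem_cat zy orbT.
Qed.

(* On the event that the cluster of [x] is [S], the second part of the event
   only involves sites outside the neighborhood of [S]. *)
Lemma prob_disjoint_event x y : Pr (disjoint_event x y) <= h k ^+ 2.
Proof.
(* The possible clusters [S] of [x] are subsets of a finite ball, so the decomposition according to
   [S] is a finite sum. *)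
pose B := [fset z in ball_seq x L]%fset.
pose isS (S : {fset site d}) : set (config d) := cluster_event x L
  (fun T => (k <= card_fin T)%N /\ T = [set` S]).
pose avoid (S : {fset site d}) : set (config d) := cluster_event y L
  (fun T => (k <= card_fin T)%N /\
     forall z, neighborhood [set` S] z -> ~ neighborhood T z).
have isS_det S : determined_by
    [seq z <- ball_seq x L.+1 | `[<neighborhood [set` S] z>]] (isS S).
  move=> w w' ww' [fC CL [kC CS]].
  suff e : cluster w' x = cluster w x by rewrite /isS /cluster_event /= e.
  have inS z : neighborhood (cluster w x) z -> w z = w' z.
    move=> zC; apply: ww'; rewrite mem_filter -CS; apply/andP; split.
      exact/asboolP.
    exact: neighborhood_radius zC.
  apply: cluster_agree => //; apply: inS; left.
  have [z Cz] : exists z, cluster w x z by exact: (card_fin_gt0 k_gt0).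
  exact: cluster_self Cz.
have avoid_det S : determined_by
    [seq z <- ball_seq y L.+1 | ~~ `[<neighborhood [set` S] z>]] (avoid S).
  move=> w w' ww' [fC CL [kC CS]].
  suff e : cluster w' y = cluster w y by rewrite /avoid /cluster_event /= e.
  have inS z : neighborhood (cluster w y) z -> w z = w' z.
    move=> zC; apply: ww'; rewrite mem_filter; apply/andP; split.
      by apply/asboolPn => /CS.
    exact: neighborhood_radius zC.
  apply: cluster_agree => //; apply: inS; left.
  have [z Cz] : exists z, cluster w y z by exact: (card_fin_gt0 k_gt0).
  exact: cluster_self Cz.
have m_isS S : measurable (isS S) := determined_measurable (isS_det S).
have m_avoid S : measurable (avoid S) := determined_measurable (avoid_det S).
have m_dis := determined_measurable (@disjoint_event_determined x y).
apply: (@le_trans _ _ (\sum_(S <- fpowerset B) Pr (isS S `&` avoid S))).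
  apply: prob_bigU_le => // [S|w [[fC CL kC] [fC' CL' kC'] dxy]].
    exact: measurableI.
  exists (fset_set (cluster w x)).
    rewrite fpowersetE; apply/fsubsetP => z.
    rewrite in_fset_set // => /set_mem Cz.
    rewrite !inE; apply/ball_seqP; exact: cluster_radius Cz.
  split; split=> //; split=> //; first by rewrite fset_setK.
  by rewrite fset_setK.
apply: (@le_trans _ _ (\sum_(S <- fpowerset B) h k * Pr (isS S))).
  apply: ler_sum => S _; rewrite (prob_indep P_iid (isS_det S) (avoid_det S)).
    rewrite mulrC ler_wpM2r ?prob_ge0 //.
    apply: le_trans (prob_size_event_le P_iid y k L).
    apply: prob_le => //; first exact: measurable_size_event.
    by move=> w [fC CL [kC _]].
  by move=> z; rewrite !mem_filter => /andP[-> _].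
rewrite -mulr_sumr expr2 ler_wpM2l ?prob_ge0 //.
apply: le_trans (prob_size_event_le P_iid x k L).
rewrite -[leRHS]mul1r; apply: (prob_sum_le P_iid p01 (s := ball_seq x L.+1)).
- by move=> S; exact: cluster_event_determined.
- exact: size_event_determined.
- move=> w; have [sw|nsw] := pselect (size_event x k L w).
    rewrite asboolT // mulr1; apply: sum_asbool_le1; first exact: fset_uniq.
    move=> S S' [_ _ [_ SC]] [_ _ [_ S'C]].
    by rewrite -(set_fsetK S) -(set_fsetK S') -SC -S'C.
  rewrite big1 ?mulr_ge0 // => S _; rewrite asboolF // => -[fC CL [kC _]].
  exact: nsw.
Qed.

(** The sites to close depend on the configuration. Recording them as a mask over the [3 ^ d] sites
    of the ball around [v] leaves a number of modifications that does not grow with the clusters, as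
    the union bound requires. *)
Definition bridge (v : site d) (m : seq bool) : seq (site d * bool) :=
  (v, true) :: [seq (z, false) | z <- mask m (ball_seq v 1)].

Lemma forceE (vs : seq (site d * bool)) w z :
  force vs w z = if z \in unzip1 vs then
    nth true (unzip2 vs) (index z (unzip1 vs)) else w z.
Proof.
elim: vs => [|[u b] vs IH] //=; rewrite /update inE eq_sym.
by case: eqP => //= _; rewrite IH.
Qed.

Lemma force_bridge v m w z :
  force (bridge v m) w z =
    if z == v then true else if z \in mask m (ball_seq v 1) then false else w z.
Proof.
rewrite /= /update /=; case: eqP => // _; rewrite forceE.
rewrite /unzip1 /unzip2 -!map_comp map_id (_ : map _ _ = nseq (size (mask m (ball_seq v 1))) false); last first.
  by elim: (mask _ _) => //= ? ? ->.
by case: ifP => // zm; rewrite nth_nseq index_mem zm.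
Qed.

(* Opening [v] and closing its neighbors outside of the two clusters merges the
   two clusters into a single finite one. *)
Lemma bridge_merges x y v w : x != y ->
  endpoint_event x k L w -> endpoint_event y k L w ->
  neighborhood (cluster w x) v -> neighborhood (cluster w y) v ->
  exists2 m : (3 ^ d).-tuple bool, v \in ball_seq x L.+1 &
    size_event x k.*2 L.*2.+1 (force (bridge v m) w).
Proof.
move=> xy [fx xL [kx lx]] [fy yL [ky ly]] vx vy.
pose C := cluster w x; pose T := cluster w y.
(* Different left endpoints mean different clusters, which are then disjoint. *)
have dis z : C z -> ~ T z.
  move=> /cluster_same ez /cluster_same ez'; move: lx; rewrite -ez ez' => lx.
  by move: xy; rewrite (left_endpoint_uniq lx ly) eqxx.
have stepC u z : C u -> adj u z -> w z -> C z.
  by rewrite /C cluster_reach; exact: reach_step.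
have stepT u z : T u -> adj u z -> w z -> T z.
  by rewrite /T cluster_reach; exact: reach_step.
have occC z : C z -> w z by rewrite /C cluster_reach; exact: reach_occ.
have occT z : T z -> w z by rewrite /T cluster_reach; exact: reach_occ.
(* An occupied site in the neighborhood of a cluster belongs to that cluster; if [v] were in one of
   the two, it would lie in both. *)
have nCv : ~ C v.
  move=> Cv; case: vy => [|[t Tt tv]]; first exact: dis.
  by apply: (dis v) => //; exact: stepT tv (occC _ Cv).
have nTv : ~ T v.
  move=> Tv; case: vx => [/dis//|[s Cs sv]].
  by apply: (dis v) => //; exact: stepC sv (occT _ Tv).
case: (vx) => [//|[s Cs sv]]; case: (vy) => [//|[t Tt tv]].
(* Closing these sites keeps any third cluster, possibly infinite, from joining through [v]. *)
pose out z := [&& z != v, ~~ `[<C z>] & ~~ `[<T z>]].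
have szm : size [seq out z | z <- ball_seq v 1] == (3 ^ d)%N.
  by rewrite size_map size_ball_seq.
exists (Tuple szm); first exact: neighborhood_radius vx.
set w' := force _ _.
have w'E z : w' z = if z == v then true
    else if out z && (z \in ball_seq v 1) then false else w z.
  by rewrite /w' force_bridge /= -filter_mask mem_filter.
have w'C z : C z -> w' z.
  move=> Cz; rewrite w'E; case: eqP => // _.
  by rewrite /out asboolT // andbF occC.
have w'T z : T z -> w' z.
  move=> Tz; rewrite w'E; case: eqP => // _.
  by rewrite /out (@asboolT (T z)) // !andbF occT.
have reachC z : reach w x z -> reach w' x z.
  elim=> [wx|u u' xu IH uu' wu'].
    by apply/reach_refl/w'C; rewrite /C cluster_reach; exact: reach_refl.
  apply: (reach_step IH uu'); apply: w'C; rewrite /C cluster_reach.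
  exact: reach_step uu' wu'.
have reachT z : reach w y z -> reach w' y z.
  elim=> [wy|u u' yu IH uu' wu'].
    by apply/reach_refl/w'T; rewrite /T cluster_reach; exact: reach_refl.
  apply: (reach_step IH uu'); apply: w'T; rewrite /T cluster_reach.
  exact: reach_step uu' wu'.
have xs : reach w' x s by apply: reachC; move: Cs; rewrite /C cluster_reach.
have xv : reach w' x v by apply: (reach_step xs sv); rewrite w'E eqxx.
have xt : reach w' x t.
  by apply: (reach_step xv); [rewrite adj_sym | exact: w'T].
have yt : reach w' y t by apply: reachT; move: Tt; rewrite /T cluster_reach.
have eU : cluster w' x = (C `|` T) `|` [set v].
  rewrite cluster_reach; apply/seteqP; split=> z /=.
    elim=> [w'x|u u' _ Uu uu' w'u'].
      by left; left; rewrite /C; case: lx.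
    have [->|/eqP u'v] := eqVneq u' v; first by right.
    left; move: w'u'; rewrite w'E; case: eqP => [//|_].
    case: ifP => // /negbT; rewrite negb_and => nout wu'.
    case: Uu => [[Cu|Tu]|uv]; [left|right|].
    - exact: stepC Cu uu' wu'.
    - exact: stepT Tu uu' wu'.
    move: nout uu'; rewrite uv => nout /adj_box vu'.
    case/orP: nout => [|/negP[]]; last by apply/ball_seqP.
    rewrite /out !negb_and !negbK => /or3P[/eqP//|/asboolP ?|/asboolP ?].
      by left.
    by right.
  case=> [[Cz|Tz]|->//]; first by apply: reachC; move: Cz; rewrite /C cluster_reach.
  apply: (reach_trans xt (reach_trans (reach_sym yt) _)).
  by apply: reachT; move: Tz; rewrite /T cluster_reach.
have fU : finite_set (C `|` T) by rewrite finite_setU.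
(* The site [v] contributes the 1, whence the cutoff [L.*2.+1]. *)
have cU : card_fin (cluster w' x) = (card_fin C + card_fin T + 1)%N.
  rewrite eU card_finU //; last by move=> z CTz zv; case: CTz; rewrite zv.
  by rewrite card_finU // /card_fin fset_set1 cardfs1.
split.
- by rewrite eU finite_setU.
- by rewrite cU addn1 ltnS -addnn leq_add.
- by rewrite cU addn1 -addnn leqW // leq_add.
Qed.

(** The number of masks, divided by the finite energy factor of the at most [3 ^ d + 1] prescribed
    sites. *)
Definition bridge_cost : R := (2 ^ (3 ^ d))%:R / (p * (1 - p)) ^+ (3 ^ d).+1.

Lemma bridge_cost_ge0 : 0 <= bridge_cost.
Proof.
have [p0 p1] := andP p01.
by rewrite /bridge_cost divr_ge0 ?ler0n // exprn_ge0 // mulr_ge0 // ?subr_ge0 ltW.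
Qed.

Lemma prob_endpoint_pair x y : x != y ->
  Pr (endpoint_event x k L `&` endpoint_event y k L)
    <= h k ^+ 2 + bridge_cost * (L.+1.*2.+1 ^ d)%:R * h k.*2.
Proof.
move=> xy; have [p0 p1] := andP p01.
pose F := size_event x k.*2 L.*2.+1.
have F_det : determined_by (ball_seq x L.*2.+2) F.
  exact: size_event_determined.
pose merged (vm : site d * (3 ^ d).-tuple bool) : set (config d) :=
  [set w | F (force (bridge vm.1 vm.2) w)].
have merged_det vm : determined_by (ball_seq x L.*2.+2) (merged vm).
  exact: determined_force.
have m_merged vm := determined_measurable (@merged_det vm).
pose c := p * (1 - p).
have c0 : 0 < c by rewrite mulr_gt0 // subr_gt0.
have c1 : c <= 1 by rewrite /c; nra.
have merged_le vm : Pr (merged vm) <= h k.*2 / c ^+ (3 ^ d).+1.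
  rewrite ler_pdivlMr ?exprn_gt0 // mulrC.
  apply: le_trans (prob_size_event_le P_iid x k.*2 L.*2.+1).
  apply: le_trans (prob_force P_iid p01 (bridge vm.1 vm.2) F_det).
  rewrite ler_wpM2r ?prob_ge0 // ler_wiXn2l //; first exact: ltW.
  rewrite /bridge /= ltnS size_map.
  have := size_subseq (mask_subseq vm.2 (ball_seq vm.1 1)).
  by rewrite size_ball_seq.
pose vms := [seq (v, m) | v <- ball_seq x L.+1, m <- enum {:(3 ^ d).-tuple bool}].
pose E o := if o is Some vm then merged vm else disjoint_event x y.
have mE o : measurable (E o).
  case: o => [vm|]; first exact: m_merged.
  exact: determined_measurable (@disjoint_event_determined x y).
apply: (@le_trans _ _ (\sum_(o <- None :: map Some vms) Pr (E o))).
  apply: prob_bigU_le => //.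
    by apply: measurableI; exact: measurable_endpoint_event.
  move=> w [Ax Ay].
  have [dxy|] := pselect (forall z, neighborhood (cluster w x) z ->
      ~ neighborhood (cluster w y) z).
    exists None; first by rewrite inE.
    by split=> //; exact: endpoint_sub_size.
  move=> /existsNP[v /not_implyP[vx /contrapT vy]].
  have [m vb Fm] := bridge_merges xy Ax Ay vx vy.
  exists (Some (v, m)) => //; rewrite inE /= map_f //.
  by apply/allpairsP; exists (v, m); rewrite mem_enum.
rewrite big_cons big_map /= lerD ?prob_disjoint_event //.
apply: (@le_trans _ _ (\sum_(vm <- vms) h k.*2 / c ^+ (3 ^ d).+1)).
  by apply: ler_sum => vm _; exact: merged_le.
rewrite big_const_seq count_predT iter_addr_0 size_allpairs size_ball_seq.
rewrite -cardE card_tuple card_bool -[leLHS]mulr_natl natrM /bridge_cost -/c.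
rewrite le_eqVlt; apply/orP; left; apply/eqP; ring.
Qed.

End Pairs.

Arguments bridge_cost {R} d p.

(** * The maximal finite cluster in a box *)

Section MaximalCluster.
Context {d : nat}.
Implicit Types (w : config d) (x : site d) (n k L : nat).

Definition box_seq n : seq (site d) := fset_set (box d n).

Lemma box_seqP n x : x \in box_seq n <-> box d n x.
Proof.
rewrite /box_seq in_fset_set; last exact: finite_box.
by split=> [/set_mem|/mem_set].
Qed.

Lemma size_box_seq n : size (box_seq n) = (n.*2.+1 ^ d)%N.
Proof. by rewrite -card_box. Qed.

Lemma box_seq_uniq n : uniq (box_seq n).
Proof. exact: fset_uniq. Qed.

Definition max_lt n k : set (config d) :=
  [set w | (max_finite_cluster n w < k)%N].

Lemma max_ltP n k w : (0 < k)%N -> max_lt n k w <->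
  forall x, x \in box_seq n -> finite_set (cluster w x) ->
    (card_fin (cluster_le (restrict_box n w) x) < k)%N.
Proof.
case: k => // k _; rewrite /max_lt /= ltnS /max_finite_cluster.
split=> [/bigmax_leqP_seq h x xn /asboolP fx|h].
  by rewrite ltnS; exact: h.
apply/bigmax_leqP_seq => x xn /asboolP fx; rewrite -ltnS; exact: h.
Qed.

Lemma restrict_determined n x k : determined_by (box_seq n)
  [set w | (card_fin (cluster_le (restrict_box n w) x) < k)%N].
Proof.
move=> w w' ww' /=; suff -> : restrict_box n w = restrict_box n w' by [].
apply/funext => z; rewrite /restrict_box.
case: asboolP; rewrite ?andbF // => zn; rewrite !andbT; apply: ww'.
exact/box_seqP.
Qed.

(** Restricted clusters are local, but the maximum runs over the sites whose cluster in the whole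
    space is finite; hence the complement of a finite union involving [finite_event]. *)
Lemma measurable_max_lt n k : (0 < k)%N -> measurable (max_lt n k).
Proof.
move=> k0.
pose E x : set (config d) := finite_event x 0
  `&` ~` [set w | (card_fin (cluster_le (restrict_box n w) x) < k)%N].
have -> : max_lt n k = ~` [set w | exists2 x, x \in box_seq n & E x w].
  apply/seteqP; split=> w.
    by move=> /(max_ltP _ _ k0) h [x xn [[fx _]]]; case; exact: h.
  move=> h; apply/(max_ltP _ _ k0) => x xn fx; apply: contrapT => nk.
  by apply: h; exists x.
apply: measurableC; apply: measurable_bigU => x; apply: measurableI.
  exact: measurable_finite_event.
apply: measurableC; exact: determined_measurable (@restrict_determined n x k).
Qed.

Lemma cluster_restrict_sub n w x :
  cluster (restrict_box n w) x `<=` cluster w x.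
Proof.
move=> y; rewrite !cluster_reach; apply: reach_le => z.
by rewrite /restrict_box => /andP[].
Qed.

(** With its boundary, a cluster of at most [L] sites stays within distance [L + 1] of [x], so the
    box does not cut it. *)
Lemma cluster_restrict n L w x : (L < n)%N -> box d (n - L.+1) x ->
  finite_set (cluster w x) -> (card_fin (cluster w x) <= L)%N ->
  cluster (restrict_box n w) x = cluster w x.
Proof.
move=> Ln xn fC CL.
have inbox z : z \in ball_seq x L.+1 -> w z = restrict_box n w z.
  move=> /ball_seqP zx; rewrite /restrict_box asboolT ?andbT //.
  by rewrite -(subrK x z) -(subnKC Ln); exact: boxD.
apply: cluster_agree; first exact: inbox (ball_seq_center _ _).
by move=> z zC; apply: inbox; exact: neighborhood_radius zC.
Qed.

Definition no_endpoint n k L : set (config d) :=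
  [set w | forall x, x \in box_seq n -> ~ endpoint_event x k L w].

Lemma max_lt_no_endpoint n k L : (0 < k)%N -> (L < n)%N ->
  max_lt n k `<=` no_endpoint (n - L.+1) k L.
Proof.
move=> k0 Ln w /(max_ltP _ _ k0) h x xn [fC CL [kC xC]].
have xbox : box d (n - L.+1) x by exact/box_seqP.
have xn' : x \in box_seq n.
  by apply/box_seqP; apply: box_le xbox; exact: leq_subr.
have := h x xn' fC.
by rewrite /cluster_le (cluster_restrict Ln) // asboolT // ltnNge kC.
Qed.

(** Restriction to the box only shrinks clusters, so a site responsible for a large maximum has a
    finite cluster of size at least [k] in the whole space. If it is neither too large nor started
    in the boundary layer, this cluster is uncut and [no_endpoint] excludes it. *)
Lemma no_endpoint_max_lt n k L w : (0 < k)%N -> (L < n)%N ->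
  no_endpoint (n - L.+1) k L w -> ~ max_lt n k w ->
  (exists2 x, x \in box_seq n & finite_event x L.+1 w) \/
  (exists2 x, x \in [seq x <- box_seq n | x \notin box_seq (n - L.+1)] &
     finite_event x k w).
Proof.
move=> k0 Ln none /(max_ltP _ _ k0).
move=> /existsNP[x /not_implyP[xn /not_implyP[fC /negP]]].
rewrite -leqNgt /cluster_le; case: asboolP => [xC kC|_]; last first.
  by rewrite /card_fin fset_set0 cardfs0 leqNgt k0.
have kC' : (k <= card_fin (cluster w x))%N.
  apply: leq_trans kC _; apply: fsubset_leq_card; rewrite -fset_set_sub //.
    exact: cluster_restrict_sub.
  by apply: sub_finite_set fC; exact: cluster_restrict_sub.
have [CL|CL] := leqP (card_fin (cluster w x)) L; last by left; exists x.
right; exists x => //; rewrite mem_filter xn andbT.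
apply/negP => xb; apply: (none x xb); split=> //; split=> //.
by rewrite -(@cluster_restrict n L) //; exact/box_seqP.
Qed.

Lemma size_shell n m : (m <= n)%N ->
  size [seq x <- box_seq n | x \notin box_seq m]
    = (n.*2.+1 ^ d - m.*2.+1 ^ d)%N.
Proof.
move=> mn; rewrite -(size_box_seq n) -(count_predC (mem (box_seq m)) (box_seq n)).
rewrite size_filter -[X in (_ - X)%N]size_box_seq.
suff -> : count (mem (box_seq m)) (box_seq n) = size (box_seq m).
  by rewrite addKn.
rewrite -size_filter; apply/perm_size/uniq_perm.
- exact/filter_uniq/box_seq_uniq.
- exact: box_seq_uniq.
- move=> x; rewrite mem_filter /=; case: (boolP (x \in box_seq m)) => //= xm.
  by apply/box_seqP; apply: box_le mn _; exact/box_seqP.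
Qed.

End MaximalCluster.

(** * The quantitative Poisson estimate *)

Section MainEstimate.
Context {R : realType} {d : nat} (P : probability (config d) R) (p : R)
  (P_iid : iid_bernoulli P p) (p01 : 0 < p < 1).

Local Notation Pr := (prob P).
Local Notation h j := (Pr (finite_event 0 j)).
Local Notation N j := ((j.*2.+1 ^ d)%N%:R : R).

(** The first two error terms bound the exceptions of [no_endpoint_max_lt] by union bounds; the last
    is the error of [no_event_prob] at range [L.+1], with [prob_endpoint_pair] as pair bound. *)
Lemma max_lt_poisson n k L : (0 < k)%N -> (L < n)%N ->
  forall q, q = Pr (endpoint_event 0 k L) ->
  `|Pr (max_lt n k) - expR (- (q * N (n - L.+1)%N))|
    <= N n * h L.+1 + (N n - N (n - L.+1)%N) * h k
       + N n * (N (L.+1 + L.+1)%N *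
           (h k ^+ 2 + bridge_cost d p * N L.+1 * h k.*2 + q ^+ 2) + q ^+ 2).
Proof.
move=> k0 Ln q qE; set m := (n - L.+1)%N.
set b := h k ^+ 2 + bridge_cost d p * N L.+1 * h k.*2.
have b0 : 0 <= b.
  apply: addr_ge0; first exact: sqr_ge0.
  apply: mulr_ge0; last exact: prob_ge0.
  by apply: mulr_ge0; [exact: bridge_cost_ge0|exact: ler0n].
have mn : (m <= n)%N by exact: leq_subr.
have Nmn : N m <= N n.
  rewrite ler_nat -!size_box_seq; apply: uniq_leq_size (box_seq_uniq m) _ => x.
  by move=> /box_seqP xm; apply/box_seqP; exact: box_le xm.
have mI : measurable (no_endpoint (d := d) m k L).
  apply: determined_measurable; apply: determined_bigI => x.
  exact: determinedC (@endpoint_event_determined d x k L).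
have mV : measurable (max_lt (d := d) n k) by exact: measurable_max_lt.
have poisson : `|Pr (no_endpoint m k L) - expR (- (q * N m))|
    <= N n * (N (L.+1 + L.+1)%N * (b + q ^+ 2) + q ^+ 2).
  have pair x y : x != y ->
      Pr (endpoint_event x k L `&` endpoint_event y k L) <= b.
    exact: prob_endpoint_pair.
  have := no_event_prob P_iid (@endpoint_event_determined d ^~ k ^~ L)
    (fun x => etrans (prob_endpoint_event P_iid x k L) (esym qE)) b0 pair (box_seq_uniq m).
  rewrite size_box_seq -expRM_natl mulrN mulrC => h1.
  apply: le_trans h1 _; apply: ler_wpM2r => //.
  apply: addr_ge0; last exact: sqr_ge0.
  by apply: mulr_ge0; [exact: ler0n|apply: addr_ge0 => //; exact: sqr_ge0].
have lower : Pr (max_lt n k) <= Pr (no_endpoint m k L).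
  by apply: prob_le => //; exact: max_lt_no_endpoint.
have upper : Pr (no_endpoint m k L) <= Pr (max_lt n k)
    + (N n * h L.+1 + (N n - N m) * h k).
  pose far : seq (site d) := [seq x <- box_seq n | x \notin box_seq m].
  pose E (o : option (site d + site d)) : set (config d) := match o with
    | None => max_lt n k
    | Some (inl x) => finite_event x L.+1
    | Some (inr x) => finite_event x k end.
  have mE o : measurable (E o).
    by case: o => [[x|x]|] //; exact: measurable_finite_event.
  have const (r : seq (site d)) j :
      \sum_(x <- r) Pr (finite_event x j) = (size r)%:R * h j.
    under eq_bigr do rewrite (prob_finite_event P_iid).
    by rewrite big_const_seq count_predT iter_addr_0 mulr_natl.
  have far_size : (size far)%:R = N n - N m.
    by rewrite size_shell // natrB // -(ler_nat R).
  have := @prob_bigU_le _ _ P _ (None :: map Some (map inl (box_seq n) ++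
    map inr far)) E _ mE mI.
  rewrite big_cons !big_map big_cat !big_map /= !const far_size size_box_seq.
  apply.
  move=> w hw; have [hV|nV] := pselect (max_lt n k w).
    by exists None => //; rewrite inE.
  case: (no_endpoint_max_lt k0 Ln hw nV) => -[x xs Ex].
    by exists (Some (inl x)) => //; rewrite inE /= map_f // mem_cat map_f.
  by exists (Some (inr x)) => //; rewrite inE /= map_f // mem_cat map_f ?orbT.
by move: poisson; rewrite !ler_norml => /andP[l u]; apply/andP; split; lra.
Qed.

End MainEstimate.

(** * Asymptotics of the tail *)

Section Powers.
Context {R : realType}.

Lemma near_powR_ge (r A : R) : 0 < r -> \forall n \near \oo, A <= n%:R `^ r.
Proof.
move=> r0; near=> n.
have An : `|A| `^ r^-1 <= n%:R by near: n; exact: nbhs_infty_ger.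
apply: (le_trans (ler_norm A)).
have -> : `|A| = (`|A| `^ r^-1) `^ r.
  by rewrite -powRrM mulVf ?lt0r_neq0 // powRr1.
by apply: (ge0_ler_powR (ltW r0)); rewrite ?nnegrE ?powR_ge0 ?ler0n.
Unshelve. all: by end_near. Qed.

(** As [m ^ i <= M ^ (2 i)], the term of degree [2 i + 1] of the exponential series leaves a bound
    of order [1 / M]. *)
Lemma poly_expR_cvg0 (M : nat -> R) (kappa : R) (i : nat) : 0 < kappa ->
  (forall A : R, \forall m \near \oo, A <= M m) ->
  (\forall m \near \oo, m%:R <= M m ^+ 2) ->
  m%:R ^+ i * expR (- (kappa * M m)) @[m --> \oo] --> (0 : R).
Proof.
move=> k0 Minf mM.
pose C : R := ((i.*2).+1)`!%:R / kappa ^+ i.*2.+1.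
have C0 : 0 < C by rewrite divr_gt0 ?exprn_gt0 // ltr0n fact_gt0.
apply/cvgrPdist_le => eps eps0; near=> m.
have Mm : C / eps <= M m by near: m; exact: Minf.
have M0 : 0 < M m by apply: lt_le_trans Mm; rewrite divr_gt0.
rewrite sub0r normrN ger0_norm ?mulr_ge0 ?expR_ge0 ?exprn_ge0 ?ler0n //.
apply: (@le_trans _ _ (C / M m)); last first.
  by rewrite ler_pdivrMr // mulrC -ler_pdivrMr.
have kM : 0 < kappa * M m by exact: mulr_gt0.
have e1 : (kappa * M m) ^+ i.*2.+1 / (i.*2.+1)`!%:R <= expR (kappa * M m).
  by apply: le_trans (expR_ge1Dxn i.*2 (ltW kM)); rewrite lerDr.
have mi : m%:R ^+ i <= M m ^+ i.*2.
  rewrite -mul2n exprM; apply: lerXn2r; rewrite ?nnegrE ?sqr_ge0 //.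
  by near: m.
rewrite expRN; apply: (@le_trans _ _
    (M m ^+ i.*2 * ((kappa * M m) ^+ i.*2.+1 / (i.*2.+1)`!%:R)^-1)).
  apply: ler_pM => //.
  by rewrite lef_pV2 ?posrE ?expR_gt0 ?divr_gt0 ?exprn_gt0 ?ltr0n ?fact_gt0.
rewrite le_eqVlt; apply/orP; left; apply/eqP; rewrite /C invf_div exprMn !exprS.
have := expf_neq0 i.*2 (lt0r_neq0 M0); have := expf_neq0 i.*2 (lt0r_neq0 k0).
move: (M m ^+ _) (kappa ^+ _) => u v v0 u0.
by field; rewrite u0 v0 !lt0r_neq0.
Unshelve. all: by end_near. Qed.

End Powers.

Section TailAsymptotics.
Context {R : realType} (d : nat) (d_ge2 : (2 <= d)%N) (H : R -> R) (eta : R).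
Hypothesis (eta_gt0 : 0 < eta).

Local Notation a := (d%:R^-1 : R).
Local Notation c := ((d%:R - 1) / d%:R : R).
Local Notation M m := ((m%:R : R) `^ c).
Local Notation lam x := (expR (- (x * eta * c))).

Hypothesis (H_ge0 : forall t, 0 <= H t)
  (H_anti : forall s t, s <= t -> H t <= H s)
  (eta_lim : - (n%:R `^ (- c) * ln (H n%:R)) @[n --> \oo] --> eta)
  (ratio_lim : forall x, H (n%:R + x * n%:R `^ a) / H n%:R @[n --> \oo]
    --> lam x).

Let d0 : 0 < d%:R :> R. Proof. by rewrite ltr0n; apply: leq_trans d_ge2. Qed.

Let d2 : 2 <= d%:R :> R. Proof. by rewrite (ler_nat R 2). Qed.

Let a0 : 0 < a. Proof. by rewrite invr_gt0. Qed.

Lemma powers_sum : c = 1 - a.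
Proof. by field; rewrite lt0r_neq0. Qed.

Let c_ge : 2^-1 <= c.
Proof. by rewrite ler_pdivlMr //; have := d2; lra. Qed.

Let c0 : 0 < c. Proof. by apply: lt_le_trans c_ge; rewrite invr_gt0. Qed.

Lemma near_M_ge (A : R) : \forall m \near \oo, A <= M m.
Proof. exact: near_powR_ge. Qed.

Lemma near_M_sq : \forall m \near \oo, m%:R <= M m ^+ 2.
Proof.
near=> m; have m1 : 1 <= m%:R :> R by near: m; exact: nbhs_infty_ger.
rewrite -powR_mulrn ?powR_ge0 // -powRrM -[leLHS]powRr1 //.
by apply: ler_powR => //; move: c_ge; lra.
Unshelve. all: by end_near. Qed.

Lemma powR_a m : m%:R `^ a * M m = m%:R :> R.
Proof.
have [->|m0] := posnP m.
  by rewrite powR0 ?lt0r_neq0 // mul0r.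
rewrite -powRD; last by rewrite pnatr_eq0 -lt0n m0 implybT.
by rewrite powers_sum addrC subrK powRr1.
Qed.

Lemma tail_gt0 t : 0 < H t.
Proof.
have : \forall n \near \oo, 0 < - (n%:R `^ (- c) * ln (H n%:R)).
  exact: cvgr_gt eta_lim _ eta_gt0.
move=> pos; near \oo => n.
have tn : t <= n%:R by near: n; exact: nbhs_infty_ger.
apply: lt_le_trans (H_anti tn); rewrite lt_neqAle H_ge0 andbT.
apply/negP => /eqP Hn0; have : 0 < - (n%:R `^ (- c) * ln (H n%:R)) by near: n.
(* Since [ln 0] is 0 by convention, a vanishing tail would give the value 0 to a sequence that is
   eventually positive. *)
by rewrite -Hn0 ln0 // mulr0 oppr0 ltxx.
Unshelve. all: by end_near. Qed.

Lemma tail_bounds (eps : R) : 0 < eps -> \forall m \near \oo,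
  expR (- ((eta + eps) * M m)) <= H m%:R <= expR (- ((eta - eps) * M m)).
Proof.
move=> eps0; have /cvgrPdist_le/(_ _ eps0) near_eta := eta_lim.
near=> m; have m1 : 1 <= m%:R :> R by near: m; exact: nbhs_infty_ger.
have Mm : 0 < M m by rewrite powR_gt0 // (lt_le_trans _ m1).
have : `|eta - - (m%:R `^ (- c) * ln (H m%:R))| <= eps by near: m.
rewrite opprK powRN ler_norml => /andP[l u].
rewrite -[H _](@lnK R) ?posrE ?tail_gt0 // !ler_expR.
have -> : ln (H m%:R) = M m * ((M m)^-1 * ln (H m%:R)).
  by rewrite mulrA mulfV ?mul1r // lt0r_neq0.
move: (_ * ln _) l u => y l u; apply/andP; split; nra.
Unshelve. all: by end_near. Qed.

(** With the rate known up to [eta / 18] and a gain of 5/4 in [M], the exponents differ by (5/4)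
    (17/18) - 19/18 = 1/8 of [eta]. *)
Let kappa := eta / 8.

Lemma tail_small : \forall m \near \oo,
  H m%:R <= expR (- (kappa * M m)).
Proof.
have e0 : 0 < eta / 18 by rewrite divr_gt0.
near=> m; have /andP[_ h] :
  expR (- ((eta + eta / 18) * M m)) <= H m%:R
    <= expR (- ((eta - eta / 18) * M m)) by near: m; exact: tail_bounds.
apply: le_trans h _; rewrite ler_expR lerN2 ler_wpM2r ?powR_ge0 // /kappa.
lra.
Unshelve. all: by end_near. Qed.

(* [(7/4) ^ c >= (7/4) ^ (1/2) >= 5/4] as [d >= 2]. *)
Lemma tail_ratio_small : \forall m \near \oo, forall j : nat,
  7 / 4 * m%:R <= j%:R :> R -> H j%:R <= H m%:R * expR (- (kappa * M m)).
Proof.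
have e0 : 0 < eta / 18 by rewrite divr_gt0.
have [N _ hN] := tail_bounds e0; exists N => // m /= Nm j mj.
have Nj : (N <= j)%N.
  apply: leq_trans Nm _; rewrite -(ler_nat R); apply: le_trans mj.
  by have := ler0n R m; lra.
have /andP[hm _] := hN m Nm; have /andP[_ hj] := hN j Nj.
apply: le_trans hj _.
apply: (@le_trans _ _ (expR (- ((eta + eta / 18) * M m))
  * expR (- (kappa * M m)))); last by rewrite ler_wpM2r // expR_ge0.
rewrite -expRD ler_expR.
have Mj : 5 / 4 * M m <= M j.
  apply: (@le_trans _ _ ((7 / 4 * m%:R) `^ c)); last first.
    by apply: (ge0_ler_powR (ltW c0)); rewrite ?nnegrE ?mulr_ge0.
  rewrite powRM // ler_wpM2r ?powR_ge0 //.
  apply: (@le_trans _ _ ((7 / 4) `^ 2^-1)); last by apply: ler_powR => //; lra.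
  rewrite powR12_sqrt // -(@ger0_norm _ (5 / 4)) // -sqrtr_sqr ler_sqrt //.
  lra.
have M0 : 0 <= M m := powR_ge0 _ _.
move: (M m) (M j) Mj M0 => u v uv u0; rewrite /kappa; nra.
Qed.

(** A natural number is at most a real [t >= 0] exactly when it is smaller than the successor of the
    integer part of [t]. For negative [t] the truncation is 0; this happens for finitely many [m]
    only. *)
Definition threshold (x : R) (m : nat) : nat :=
  (Num.truncn (m%:R + x * m%:R `^ a)).+1.

(* [m ^ (1/d) = m / M m] is negligible with respect to [m]. *)
Lemma threshold_near (x eps : R) : 0 < eps -> \forall m \near \oo,
  [/\ 0 <= m%:R + x * m%:R `^ a, (1 - eps) * m%:R <= (threshold x m)%:R &
      (threshold x m)%:R <= (1 + eps) * m%:R].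
Proof.
move=> e0'; pose e := Num.min eps 2^-1.
have e0 : 0 < e by rewrite /e lt_min e0' /= invr_gt0 ltr0n.
have ee : e <= eps by rewrite /e ge_min lexx.
have e1 : e <= 2^-1 by rewrite /e ge_min lexx orbT.
near=> m; have m1 : 1 <= m%:R :> R by near: m; exact: nbhs_infty_ger.
have me : 2 / e <= m%:R :> R by near: m; exact: nbhs_infty_ger.
have Me : 2 * `|x| / e <= M m by near: m; exact: near_M_ge.
have xm : `|x * m%:R `^ a| <= e / 2 * m%:R.
  rewrite normrM (ger0_norm (powR_ge0 _ _)) -[in leRHS](powR_a m).
  rewrite mulrCA mulrC ler_wpM2l ?powR_ge0 //.
  by move: Me; rewrite ler_pdivrMr //; nra.
have me' : 1 <= e / 2 * m%:R by move: me; rewrite ler_pdivrMr //; nra.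
move: xm; rewrite ler_norml => /andP[l u].
have em : e * m%:R <= eps * m%:R by rewrite ler_wpM2r.
have em2 : e * m%:R <= 2^-1 * m%:R by rewrite ler_wpM2r.
have t0 : 0 <= m%:R + x * m%:R `^ a by lra.
have /andP[tl tu] := truncn_itv t0.
split=> //; rewrite /threshold.
- by apply: le_trans (ltW tu); lra.
- by rewrite -natr1; lra.
Unshelve. all: by end_near. Qed.

(** Rounding moves the argument by at most 1, hence by at most [eps * m ^ (1/d)] for large [m]: the
    tail at the threshold lies between those at [x] and at [x + eps]. *)
Lemma tail_threshold x :
  H (threshold x m)%:R / H m%:R @[m --> \oo] --> lam x.
Proof.
apply/cvgrPdist_le => delta delta0.
pose th := eta * c; have th0 : 0 < th by exact: mulr_gt0.
(* Chosen so that the linear bound on the decrease of [lam] from [x] to [x + eps] is [delta / 2]. *)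
pose eps := delta / 2 / (lam x * th).
have l0 := expR_gt0 (- (x * eta * c)).
have eps0 : 0 < eps by rewrite divr_gt0 ?divr_gt0 // mulr_gt0.
have lam_eps : lam x - delta / 2 <= lam (x + eps).
  rewrite (_ : lam (x + eps) = lam x * expR (- (eps * th))); last first.
    by rewrite -expRD; congr expR; rewrite /th; ring.
  apply: (@le_trans _ _ (lam x * (1 - eps * th))).
    rewrite mulrBr mulr1 lerD2l lerN2 /eps le_eqVlt; apply/orP; left.
    by apply/eqP; field; rewrite !lt0r_neq0.
  by rewrite ler_wpM2l ?expR_ge0 // expR_ge1Dx.
have d20 : 0 < delta / 2 by rewrite divr_gt0.
have /cvgrPdist_le/(_ _ d20) up := @ratio_lim x.
have /cvgrPdist_le/(_ _ d20) low := @ratio_lim (x + eps).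
near=> m.
have [tm _ _] : [/\ 0 <= m%:R + x * m%:R `^ a,
   (1 - 1) * m%:R <= (threshold x m)%:R :> R &
   (threshold x m)%:R <= (1 + 1) * m%:R :> R].
  by near: m; exact: threshold_near.
have ma : eps^-1 <= m%:R `^ a by near: m; exact: near_powR_ge.
have hm := tail_gt0 m%:R.
have /andP[tl tu] := truncn_itv tm.
have up' : H (threshold x m)%:R / H m%:R <= H (m%:R + x * m%:R `^ a) / H m%:R.
  by rewrite ler_pM2r ?invr_gt0 //; apply: H_anti; exact: ltW.
have low' : H (m%:R + (x + eps) * m%:R `^ a) / H m%:R
    <= H (threshold x m)%:R / H m%:R.
  rewrite ler_pM2r ?invr_gt0 //; apply: H_anti.
  rewrite /threshold -natr1 mulrDl addrA lerD //.
  by rewrite mulrC -ler_pdivrMr // mul1r.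
have : `|lam x - H (m%:R + x * m%:R `^ a) / H m%:R| <= delta / 2 by near: m.
have : `|lam (x + eps) - H (m%:R + (x + eps) * m%:R `^ a) / H m%:R|
  <= delta / 2 by near: m.
rewrite !ler_norml => /andP[l1 u1] /andP[l2 u2]; apply/andP; split; lra.
Unshelve. all: by end_near. Qed.

(** One unit is eventually less than [eps * m ^ (1/d)], and [lam eps] is close to 1 for small
    [eps]. *)
Lemma tail_succ : H m.+1%:R / H m%:R @[m --> \oo] --> (1 : R).
Proof.
apply/cvgrPdist_le => delta delta0.
pose th := eta * c; have th0 : 0 < th by exact: mulr_gt0.
pose eps := delta / 2 / th.
have eps0 : 0 < eps by rewrite !divr_gt0.
have lam_eps : 1 - delta / 2 <= lam eps.
  rewrite (_ : delta / 2 = eps * eta * c); first exact: expR_ge1Dx.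
  by rewrite -mulrA /eps mulfVK // lt0r_neq0.
have d20 : 0 < delta / 2 by rewrite divr_gt0.
have /cvgrPdist_le/(_ _ d20) low := @ratio_lim eps.
near=> m.
have ma : eps^-1 <= m%:R `^ a by near: m; exact: near_powR_ge.
have hm := tail_gt0 m%:R.
have up' : H m.+1%:R / H m%:R <= 1.
  by rewrite ler_pdivrMr // mul1r; apply: H_anti; rewrite ler_nat.
have low' : H (m%:R + eps * m%:R `^ a) / H m%:R <= H m.+1%:R / H m%:R.
  rewrite ler_pM2r ?invr_gt0 //; apply: H_anti.
  by rewrite -natr1 lerD2l mulrC -ler_pdivrMr // mul1r.
have : `|lam eps - H (m%:R + eps * m%:R `^ a) / H m%:R| <= delta / 2 by near: m.
rewrite !ler_norml => /andP[l1 u1]; apply/andP; split; lra.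
Unshelve. all: by end_near. Qed.

(** [q k L] stands for the probability of [endpoint_event 0 k L], and the last two hypotheses for
    the mass transport bounds. *)
Variables (q : nat -> nat -> R).
Hypothesis (q_ge0 : forall k L, 0 <= q k L)
  (q_upper : forall k L, (0 < k)%N -> k%:R * q k L <= H k%:R)
  (q_lower : forall k L L', (0 < k)%N -> (k <= L'.+1)%N -> (L' <= L)%N ->
    H k%:R - H L'.+1%:R <= L'%:R * q k L).

Lemma near_le_4 x : \forall m \near \oo, (threshold x m <= 4 * m)%N.
Proof.
near=> m.
have [_ _] : [/\ 0 <= m%:R + x * m%:R `^ a,
   (1 - 1) * m%:R <= (threshold x m)%:R :> R &
   (threshold x m)%:R <= (1 + 1) * m%:R :> R].
  by near: m; exact: threshold_near.
have m0 : 0 <= m%:R :> R := ler0n _ _.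
by rewrite -(ler_nat R) natrM => h; lra.
Unshelve. all: by end_near. Qed.

(* [k q(k, L)] compares with [H k - H k'] for [k' = threshold (x + K)], and
   [H k'] is a small fraction of [H m] once [K] is large. *)
Lemma endpoint_threshold x :
  m%:R * q (threshold x m) (4 * m) / H m%:R @[m --> \oo] --> lam x.
Proof.
apply/cvgrPdist_le => delta delta0.
pose th := eta * c; have th0 : 0 < th by exact: mulr_gt0.
have l0 := expR_gt0 (- (x * eta * c)).
set l := lam x in l0 *.
(* Since exp(- y) <= 1 / y, this makes [lam (x + K)] at most [l / (K * th) = delta / 8]. *)
pose K := 8 * l / (delta * th).
have K0 : 0 < K by apply: divr_gt0; exact: mulr_gt0.
have lam_K : lam (x + K) <= delta / 8.
  rewrite (_ : lam (x + K) = l * expR (- (K * th))); last first.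
    by rewrite -expRD; congr expR; rewrite /th; ring.
  have Kth : 0 < K * th by exact: mulr_gt0.
  rewrite expRN ler_pdivrMr ?expR_gt0 //.
  apply: (@le_trans _ _ (delta / 8 * (K * th))).
    rewrite /K le_eqVlt; apply/orP; left; apply/eqP.
    by field; rewrite !lt0r_neq0.
  rewrite ler_wpM2l ?divr_ge0 // ?ltW //.
  by apply: lt_le_trans (expR_ge1Dx _); rewrite ltrDr.
(* Replacing the thresholds by [m] costs a relative error [e], which moves [l + delta] by exactly
   [delta / 2]. *)
pose e := delta / (2 * (l + delta)).
have ld : 0 < l + delta by exact: addr_gt0.
have e0 : 0 < e by rewrite divr_gt0 // mulr_gt0.
have el : e * (l + delta) = delta / 2.
  by rewrite /e; field; rewrite lt0r_neq0.
have e1 : e < 1 by rewrite ltr_pdivrMr ?mulr_gt0 //; lra.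
have d8 : 0 < delta / 8 by rewrite divr_gt0.
have /cvgrPdist_le/(_ _ d8) F := @tail_threshold x.
have /cvgrPdist_le/(_ _ d8) FK := @tail_threshold (x + K).
near=> m.
have m1 : 1 <= m%:R :> R by near: m; exact: nbhs_infty_ger.
have [tm kl ku] : [/\ 0 <= m%:R + x * m%:R `^ a,
   (1 - e) * m%:R <= (threshold x m)%:R :> R &
   (threshold x m)%:R <= (1 + e) * m%:R :> R].
  by near: m; exact: threshold_near.
have [_ _ ku'] : [/\ 0 <= m%:R + (x + K) * m%:R `^ a,
   (1 - e) * m%:R <= (threshold (x + K) m)%:R :> R &
   (threshold (x + K) m)%:R <= (1 + e) * m%:R :> R].
  by near: m; exact: threshold_near.
have k4 : (threshold (x + K) m <= 4 * m)%N by near: m; exact: near_le_4.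
have : `|l - H (threshold x m)%:R / H m%:R| <= delta / 8 by near: m.
have : `|lam (x + K) - H (threshold (x + K) m)%:R / H m%:R| <= delta / 8.
  by near: m.
have kk : (threshold x m <= threshold (x + K) m)%N.
  rewrite ltnS; apply: le_truncn; rewrite lerD2l ler_wpM2r ?powR_ge0 //.
  by rewrite lerDl ltW.
have hm := tail_gt0 m%:R.
have lamK0 := expR_ge0 (- ((x + K) * eta * c)).
have qu := @q_upper (threshold x m) (4 * m) isT.
have ql := @q_lower (threshold x m) (4 * m)
  (Num.truncn (m%:R + (x + K) * m%:R `^ a)) isT kk (ltnW k4).
have q0 := q_ge0 (threshold x m) (4 * m).
have nk : (Num.truncn (m%:R + (x + K) * m%:R `^ a))%:R
    <= (threshold (x + K) m)%:R :> R by rewrite ler_nat.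
rewrite -/(threshold _ _) in ql.
move: (q _ _) (threshold x m)%:R (threshold (x + K) m)%:R
  (Num.truncn _)%:R kl ku ku' nk qu ql q0 => Q k k' k1 kl ku ku' nk qu ql q0.
rewrite !ler_norml => /andP[lK uK] /andP[lk uk].
have hk : H k <= (l + delta / 8) * H m%:R.
  by rewrite -ler_pdivrMr //; lra.
have hk' : H k - H k' >= (l - delta / 8 - delta / 4) * H m%:R.
  rewrite -ler_pdivlMr // mulrBl; lra.
have up : m%:R * Q / H m%:R <= l + delta.
  rewrite ler_pdivrMr //.
  have h1 : (1 - e) * (m%:R * Q) <= (l + delta / 8) * H m%:R.
    by apply: le_trans hk; apply: le_trans qu; rewrite mulrA ler_wpM2r.
  have h2 : (l + delta / 8) * H m%:R <= (1 - e) * ((l + delta) * H m%:R).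
    rewrite mulrA ler_wpM2r ?ltW //; lra.
  by have := le_trans h1 h2; rewrite ler_pM2l // subr_gt0.
have low : l - delta <= m%:R * Q / H m%:R.
  rewrite ler_pdivlMr //.
  have h1 : (l - delta / 8 - delta / 4) * H m%:R <= (1 + e) * (m%:R * Q).
    apply: le_trans hk' (le_trans ql _); rewrite mulrA ler_wpM2r //.
    exact: le_trans nk ku'.
  have h2 : (1 + e) * ((l - delta) * H m%:R)
      <= (l - delta / 8 - delta / 4) * H m%:R.
    have ed : 0 <= e * delta by rewrite mulr_ge0 // ltW.
    rewrite mulrA ler_wpM2r ?ltW //; lra.
  by have := le_trans h2 h1; rewrite ler_pM2l // ltr_pwDr // ltW.
by apply/andP; split; lra.
Unshelve. all: by end_near. Qed.
End TailAsymptotics.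

(** * The choice of the scale *)

Section Scale.
Context {R : realType} (d : nat) (d_gt0 : (0 < d)%N) (H : R -> R).
Hypothesis (H_gt0 : forall t, 0 < H t) (H_le1 : forall t, H t <= 1)
  (H_anti : forall s t, s <= t -> H t <= H s)
  (H_succ : H m.+1%:R / H m%:R @[m --> \oo] --> (1 : R)).

Local Notation N j := ((j.*2.+1 ^ d)%N%:R : R).

Lemma volume_ge n : n%:R <= N n.
Proof.
rewrite ler_nat; apply: (@leq_trans n.*2.+1).
  by rewrite -addnn leqW // leq_addr.
by rewrite -{1}[n.*2.+1]expn1 leq_pexp2l.
Qed.

Let scale_exists n : exists m, N n * H m.+1%:R <= m.+1%:R.
Proof.
exists (n.*2.+1 ^ d)%N; apply: (@le_trans _ _ (N n)).
  by rewrite -[leRHS]mulr1 ler_wpM2l.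
by rewrite ler_nat.
Qed.

(* The least [m >= 1] with [N n * H m <= m]: at this scale the expected number
   of clusters of size at least [m] is of order [1]. *)
Definition scale n : nat := (ex_minn (scale_exists n)).+1.

Lemma scale_upper n : N n * H (scale n)%:R <= (scale n)%:R.
Proof. by rewrite /scale; case: ex_minnP. Qed.

Lemma scale_lower n j : (0 < j)%N -> (j < scale n)%N -> j%:R < N n * H j%:R.
Proof.
rewrite /scale; case: ex_minnP => m _ minm; case: j => // j _ jm.
by rewrite ltNge; apply/negP => /minm; rewrite leqNgt -ltnS jm.
Qed.

Lemma scale_cvg : scale n @[n --> \oo] --> \oo.
Proof.
apply/cvgnyPge => A; near=> n.
have hA := H_gt0 A%:R.
rewrite leqNgt; apply/negP => /ltnW sA.
have nA : A%:R / H A%:R + 1 <= n%:R by near: n; exact: nbhs_infty_ger.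
have : N n * H A%:R <= A%:R.
  apply: (@le_trans _ _ (scale n)%:R); last by rewrite ler_nat.
  apply: le_trans (scale_upper n); rewrite ler_wpM2l //.
  by apply: H_anti; rewrite ler_nat.
rewrite -ler_pdivlMr // => NA; have := volume_ge n; lra.
Unshelve. all: by end_near. Qed.

Lemma near_scale (Q : nat -> Prop) :
  (\forall m \near \oo, Q m) -> \forall n \near \oo, Q (scale n).
Proof. by move=> hQ; apply: scale_cvg. Qed.

(** Here [s] is the scale and [u] its predecessor, so [u < N * Hu] by minimality. Passing from [u]
    to [s] and from [Hu] to [Hs] costs a factor [1 - e] each. *)
Lemma scale_volume_ineq (N Hu u s Hs e : R) : 0 <= N -> 0 < Hu -> 0 <= Hs ->
  0 <= u -> s = u + 1 -> 0 < e -> 1 <= e * s -> u < N * Hu ->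
  `|1 - Hs / Hu| <= e -> (1 - 2 * e) * s <= N * Hs.
Proof.
move=> N0 Hu0 Hs0 u0 su e0 es uN; rewrite ler_norml => /andP[_ h].
have h' : (1 - e) * Hu <= Hs by rewrite -ler_pdivlMr //; lra.
have [e1|e1] := lerP 1 e; first by have := mulr_ge0 N0 Hs0; nra.
have := ler_wpM2l N0 h'; nra.
Qed.

Lemma scale_volume :
  N n * H (scale n)%:R / (scale n)%:R @[n --> \oo] --> (1 : R).
Proof.
apply/cvgrPdist_le => delta delta0; pose e := delta / 2.
have e0 : 0 < e by rewrite divr_gt0.
have /cvgrPdist_le/(_ _ e0) [n1 _ n1P] := H_succ.
near=> n.
have s1 : (n1 + 2 <= scale n)%N.
  by near: n; exact: (near_scale (nbhs_infty_ge _)).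
have se : e^-1 <= (scale n)%:R by near: n; exact: (near_scale (nbhs_infty_ger _)).
have s0 : 0 < (scale n)%:R :> R by rewrite ltr0n.
have up : N n * H (scale n)%:R / (scale n)%:R <= 1.
  by rewrite ler_pdivrMr // mul1r scale_upper.
set u := (scale n).-1.
have us : scale n = u.+1 by rewrite /u prednK.
have u0 : (0 < u)%N by lia.
have ul : (u%:R : R) < N n * H u%:R by apply: scale_lower => //; lia.
have hu : `|1 - H u.+1%:R / H u%:R| <= e by apply: n1P => /=; lia.
have s_gt1 : 1 <= e * (scale n)%:R by rewrite mulrC -ler_pdivrMr // mul1r.
have us' : (scale n)%:R = u%:R + 1 :> R by rewrite us -natr1.
rewrite -us in hu; have de : delta = 2 * e by rewrite /e; field.
rewrite de ler_norml (le_trans _ (_ : 0 <= _)) ?subr_ge0 //=; last first.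
  by rewrite oppr_le0 mulr_ge0 // ltW.
rewrite lerBlDr -lerBlDl ler_pdivlMr //.
apply: (scale_volume_ineq (Hu := H u%:R) (u := u%:R)) => //; exact: ltW.
Unshelve. all: by end_near. Qed.


End Scale.

(** * The Gumbel limit *)

Lemma bernoulli_ineq (R : realType) (y : R) d : 0 <= y <= 1 ->
  1 - d%:R * y <= (1 - y) ^+ d.
Proof.
move=> /andP[y0 y1]; elim: d => [|d IH]; first by rewrite mul0r subr0 expr0.
rewrite exprS -natr1; have d0 : 0 <= d%:R :> R := ler0n _ _.
apply: (@le_trans _ _ ((1 - y) * (1 - d%:R * y))).
  by have := mulr_ge0 d0 (mulr_ge0 y0 y0); nra.
by rewrite ler_wpM2l // subr_ge0.
Qed.

Section PoissonLimit.
Context {R : realType} (d : nat) (d_gt0 : (0 < d)%N).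
Local Notation N j := ((j.*2.+1 ^ d)%N%:R : R).

(** In the application [H] is the tail, [E] a stretched exponential, [V n j] the probability of
    [max_lt n j], [v] the scale, [k] the threshold, [C] the bridge cost and [l] the limiting Poisson
    mean. *)
Context (H E : nat -> R) (q V : nat -> nat -> R) (v k : nat -> nat) (C l : R).
Hypothesis (H_gt0 : forall m, 0 < H m) (E_ge0 : forall m, 0 <= E m)
  (q_ge0 : forall k L, 0 <= q k L)
  (q_upper : forall k L, (0 < k)%N -> k%:R * q k L <= H k)
  (C_ge0 : 0 <= C) (l_gt0 : 0 < l)
  (V_poisson : forall n k L, (0 < k)%N -> (L < n)%N ->
    `|V n k - expR (- (q k L * N (n - L.+1)%N))|
      <= N n * H L.+1 + (N n - N (n - L.+1)%N) * H k
         + N n * (N (L.+1 + L.+1)%N * (H k ^+ 2 + C * N L.+1 * H k.*2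
             + q k L ^+ 2) + q k L ^+ 2))
  (v_gt0 : forall n, (0 < v n)%N)
  (v_near : forall Q : nat -> Prop,
    (\forall m \near \oo, Q m) -> \forall n \near \oo, Q (v n))
  (v_upper : forall n, N n * H (v n) <= (v n)%:R)
  (v_volume : N n * H (v n) / (v n)%:R @[n --> \oo] --> (1 : R))
  (v_poly : forall i, (v n)%:R ^+ i * E (v n) @[n --> \oo] --> (0 : R))
  (HE : \forall m \near \oo, H m <= E m)
  (HHE : \forall m \near \oo, forall j : nat,
    7 / 4 * m%:R <= j%:R :> R -> H j <= H m * E m)
  (k_gt0 : forall m, (0 < k m)%N)
  (k_near : \forall m \near \oo, 7 / 8 * m%:R <= (k m)%:R :> R)
  (H_k : H (k m) / H m @[m --> \oo] --> l)
  (q_k : m%:R * q (k m) (4 * m) / H m @[m --> \oo] --> l).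

Let v_cvg : v n @[n --> \oo] --> \oo.
Proof. by move=> Q; exact: v_near. Qed.

Let z n : R := (v n)%:R ^+ 2 / n.*2.+1%:R.

Let z_ge0 n : 0 <= z n.
Proof. by rewrite divr_ge0 // exprn_ge0. Qed.

(** As [v_volume] makes [N n * H (v n)] at least 1/2 for large [n], the volume is at least
    [1 / (2 * E (v n))], which exceeds any power of [v n]; compare the [d]-th powers. *)
Lemma scale_sq_cvg0 : z n @[n --> \oo] --> (0 : R).
Proof.
apply/cvgrPdist_le => eps eps0.
have e2 : 0 < eps ^+ d / 2 by rewrite divr_gt0 // exprn_gt0.
have h2 : 0 < (2^-1 : R) by rewrite invr_gt0.
have /cvgrPdist_lt/(_ _ e2) small := @v_poly (2 * d).
have /cvgrPdist_le/(_ _ h2) alpha := v_volume.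
near=> n.
have s0 : 0 < (v n)%:R :> R by rewrite ltr0n.
have s1 : 1 <= (v n)%:R :> R by rewrite (ler_nat R 1).
rewrite sub0r normrN ger0_norm //.
have : `|0 - (v n)%:R ^+ (2 * d) * E (v n)| < eps ^+ d / 2 by near: n.
rewrite sub0r normrN ger0_norm ?mulr_ge0 ?exprn_ge0 // => sm.
have : `|1 - N n * H (v n) / (v n)%:R| <= 2^-1 by near: n.
rewrite ler_norml => /andP[_ al].
have hE : H (v n) <= E (v n) by near: n; exact: (v_near HE).
apply: ltW; rewrite -(ltr_pXn2r d_gt0) ?nnegrE ?z_ge0 ?(ltW eps0) //=.
rewrite /z expr_div_n -exprM -[n.*2.+1%:R ^+ d]natrX.
have Nn0 : 0 < N n by rewrite ltr0n expn_gt0.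
rewrite ltr_pdivrMr //.
have NH : 1 <= 2 * (N n * H (v n)).
  have : 2^-1 <= N n * H (v n) / (v n)%:R by lra.
  by rewrite ler_pdivlMr //; lra.
have se0 : 0 <= (v n)%:R ^+ (2 * d) :> R by rewrite exprn_ge0.
apply: (@le_lt_trans _ _ ((v n)%:R ^+ (2 * d) * (2 * (N n * E (v n))))).
  rewrite -[leLHS]mulr1; apply: ler_wpM2l => //; apply: le_trans NH _.
  by apply: ler_wpM2l => //; apply: ler_wpM2l => //; exact: ltW.
have -> : (v n)%:R ^+ (2 * d) * (2 * (N n * E (v n)))
  = 2 * N n * ((v n)%:R ^+ (2 * d) * E (v n)) by ring.
have -> : eps ^+ d * N n = 2 * N n * (eps ^+ d / 2) by field.
by rewrite ltr_pM2l // mulr_gt0.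
Unshelve. all: by end_near. Qed.

(* [y] is the proportion of the side of the box taken by the boundary layer. *)
Let y n : R := (4 * v n).+1.*2%:R / n.*2.+1%:R.

Let y_ge0 n : 0 <= y n. Proof. by rewrite divr_ge0. Qed.

(** The constant comes from [2 * (4 * v + 1) <= 10 * v]. The extra factor [v n] is the one in
    [N n * H (v n) <= v n], by which the layer is weighted in [error_bound]. *)
Let vy_le n : (v n)%:R * y n <= 10 * z n.
Proof.
rewrite /y /z mulrA [leRHS]mulrA ler_wpM2r ?invr_ge0 // expr2.
rewrite (_ : 10 * _ = (10 * (v n * v n))%N%:R); last by rewrite !natrM.
by rewrite -natrM ler_nat; have := v_gt0 n; nia.
Qed.

Let y_le n : y n <= 10 * z n.
Proof.
apply: le_trans (vy_le n); rewrite -[leLHS]mul1r ler_wpM2r //.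
by rewrite (ler_nat R 1).
Qed.

Let near_y_lt1 : \forall n \near \oo, y n <= 2^-1.
Proof.
have e : 0 < (20^-1 : R) by rewrite invr_gt0.
have /cvgrPdist_le/(_ _ e) hz := scale_sq_cvg0.
near=> n; have : `|0 - z n| <= 20^-1 by near: n.
by rewrite sub0r normrN ger0_norm // => h; apply: le_trans (y_le n) _; lra.
Unshelve. all: by end_near. Qed.

(** The side of the inner box is exactly [1 - y n] times that of the full box, and Bernoulli's
    inequality applies to the volumes. *)
Let layer n : y n <= 2^-1 -> (4 * v n < n)%N /\
  (1 - d%:R * y n) * N n <= N (n - (4 * v n).+1)%N.
Proof.
move=> y1; have n0 : 0 < n.*2.+1%:R :> R by rewrite ltr0n.
have Ln : (4 * v n < n)%N.
  move: (y1); rewrite ler_pdivrMr // => h.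
  have : (4 * v n).+1.*2.*2%:R <= n.*2.+1%:R :> R.
    by rewrite -[in leLHS]muln2 natrM; lra.
  by rewrite ler_nat; lia.
split=> //.
have -> : N (n - (4 * v n).+1)%N = (1 - y n) ^+ d * N n.
  rewrite !natrX -exprMn; congr (_ ^+ _).
  rewrite mulrBl mul1r divfK ?lt0r_neq0 // -natrB; last by lia.
  by congr (_%:R); lia.
rewrite ler_wpM2r // bernoulli_ineq // y_ge0; lra.
Qed.

(** Over the full box the mean is the product of [f], which tends to [l] by [q_k], and [g], which
    tends to 1 by the choice of the scale; the inner box loses a vanishing proportion. *)
Let rate_cvg :
  q (k (v n)) (4 * v n) * N (n - (4 * v n).+1)%N @[n --> \oo] --> l.
Proof.
pose f n := (v n)%:R * q (k (v n)) (4 * v n) / H (v n).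
pose g n := N n * H (v n) / (v n)%:R.
have fl : f n @[n --> \oo] --> l by exact: cvg_comp v_cvg q_k.
have fg : f n * g n @[n --> \oo] --> l.
  by rewrite -[X in _ --> X]mulr1; exact: cvgM.
have lower : f n * g n * (1 - d%:R * (10 * z n)) @[n --> \oo] --> l.
  rewrite -[X in _ --> X]mulr1; apply: cvgM => //.
  rewrite -[X in _ --> X]subr0; apply: cvgB; first exact: cvg_cst.
  rewrite -(mulr0 d%:R) -(mulr0 10).
  by apply: cvgMr; apply: cvgMr; exact: scale_sq_cvg0.
apply: squeeze_cvgr lower fg; near=> n.
have [|Ln low] := @layer n; first by near: n; exact: near_y_lt1.
have s0 : 0 < (v n)%:R :> R by rewrite ltr0n.
have fgE : f n * g n = q (k (v n)) (4 * v n) * N n.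
  by rewrite /f /g; field; rewrite !lt0r_neq0.
rewrite fgE; apply/andP; split; last first.
  apply: ler_wpM2l => //; rewrite ler_nat leq_exp2r // ltnS leq_double.
  exact: leq_subr.
rewrite -mulrA; apply: ler_wpM2l => //; apply: le_trans low; rewrite mulrC.
apply: ler_wpM2r => //; rewrite lerD2l lerN2; exact: ler_wpM2l.
Unshelve. all: by end_near. Qed.

(** The side is [16 * m + 5], at most [21 * m]. *)
Let ball_volume m : (0 < m)%N ->
  N ((4 * m).+1 + (4 * m).+1)%N <= 21 ^+ d * m%:R ^+ d.
Proof.
move=> m0; rewrite -exprMn natrX lerXn2r ?nnegrE ?mulr_ge0 //.
by rewrite -natrM ler_nat; lia.
Qed.

(** The 3 counts the square of the tail and the two occurrences of the square of [q]; the last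
    factor comes from two ball volumes. *)
Let D : R := (3 * (l + 1) ^+ 2 + C) * (21 ^+ d) ^+ 2.

(** Every term contains [N n * H m], at most [m] by the choice of the scale, times either a power of
    [m] and the small factor [E m], or the proportion of the layer. *)
Let error_bound : \forall n \near \oo,
  `|V n (k (v n)) - expR (- (q (k (v n)) (4 * v n) * N (n - (4 * v n).+1)%N))|
  <= (v n)%:R ^+ 1 * E (v n) + 10 * d%:R * (l + 1) * z n
     + D * ((v n)%:R ^+ (2 * d).+1 * E (v n)).
Proof.
have /cvgrPdist_le/(_ _ ltr01) H_k1 := H_k.
near=> n.
have hE : H (v n) <= E (v n) by near: n; exact: (v_near HE).
have hhE : forall j : nat, 7 / 4 * (v n)%:R <= j%:R :> R ->
    H j <= H (v n) * E (v n) by near: n; exact: (v_near HHE).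
have kl : 7 / 8 * (v n)%:R <= (k (v n))%:R :> R.
  by near: n; exact: (v_near k_near).
have : `|l - H (k (v n)) / H (v n)| <= 1 by near: n; exact: (v_near H_k1).
have y_half : y n <= 2^-1 by near: n; exact: near_y_lt1.
have [Ln low] := layer y_half.
move: low Ln hE hhE kl; set m := v n => low Ln hE hhE kl.
set kk := k m in kl *; set W := N ((4 * m).+1 + (4 * m).+1)%N.
have Hm := H_gt0 m; have Em := E_ge0 m.
rewrite ler_norml => /andP[lk _].
have m0 : (0 < m)%N by exact: v_gt0.
have k0 : (0 < kk)%N by exact: k_gt0.
have m1 : 1 <= m%:R :> R by rewrite (ler_nat R 1).
apply: le_trans (V_poisson k0 Ln) _; rewrite -/m -/kk.
have Hk : H kk <= (l + 1) * H m by rewrite -ler_pdivrMr //; lra.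
have hL : H (4 * m).+1 <= H m * E m.
  by apply: hhE; rewrite -[(4 * m).+1]addn1 natrD natrM; lra.
have h2k : H kk.*2 <= H m * E m by apply: hhE; rewrite -muln2 natrM; lra.
have qk : q kk (4 * m) <= H kk.
  apply: le_trans (@q_upper kk (4 * m) k0); rewrite -[leLHS]mul1r ler_wpM2r //.
  by rewrite (ler_nat R 1).
have Nv : N n * H m <= m%:R by exact: v_upper.
have N0 : 0 <= N n by exact: ler0n.
have Hk0 := ltW (H_gt0 kk); have q0 := q_ge0 kk (4 * m).
have B0 : 0 <= l + 1 by rewrite addr_ge0 // ltW.
(* One factor [H m] is kept to absorb the volume [N n], the other is traded for [E m]. *)
have Hk2 : H kk ^+ 2 <= (l + 1) ^+ 2 * H m * E m.
  apply: (@le_trans _ _ (((l + 1) * H m) ^+ 2)).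
    by rewrite lerXn2r ?nnegrE // mulr_ge0 // ltW.
  by rewrite exprMn -[leRHS]mulrA ler_wpM2l ?exprn_ge0 // expr2 ler_wpM2l // ltW.
have q2 : q kk (4 * m) ^+ 2 <= (l + 1) ^+ 2 * H m * E m.
  by apply: le_trans Hk2; rewrite lerXn2r ?nnegrE.
have W1 : 1 <= W by rewrite (ler_nat R 1) expn_gt0.
have NW : N (4 * m).+1 <= W by rewrite ler_nat leq_exp2r // ltnS leq_double leq_addr.
have WD : W <= 21 ^+ d * m%:R ^+ d by exact: ball_volume.
apply: lerD; first apply: lerD.
- rewrite expr1; apply: (@le_trans _ _ (N n * H m * E m)).
    by rewrite -mulrA ler_wpM2l.
  by rewrite ler_wpM2r.
- apply: (@le_trans _ _ (d%:R * y n * N n * ((l + 1) * H m))).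
    apply: ler_pM => //; last by lra.
    by rewrite subr_ge0 ler_nat leq_exp2r // ltnS leq_double; exact: leq_subr.
  apply: (@le_trans _ _ (d%:R * (l + 1) * (y n * m%:R))).
    rewrite (_ : d%:R * y n * N n * ((l + 1) * H m)
      = d%:R * (l + 1) * (y n * (N n * H m))); last by ring.
    by rewrite !ler_wpM2l ?mulr_ge0.
  rewrite (_ : 10 * d%:R * (l + 1) * z n = d%:R * (l + 1) * (10 * z n));
    last by ring.
  by rewrite ler_wpM2l ?mulr_ge0 // mulrC; exact: vy_le.
set B2 := (l + 1) ^+ 2 in Hk2 q2 *.
have B20 : 0 <= B2 by rewrite exprn_ge0.
have HE0 : 0 <= H m * E m by rewrite mulr_ge0 // ltW.
have W0 : 0 <= W by apply: le_trans W1.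
have inner : H kk ^+ 2 + C * N (4 * m).+1 * H kk.*2 + q kk (4 * m) ^+ 2
    <= (2 * B2 + C * W) * (H m * E m).
  have : C * N (4 * m).+1 * H kk.*2 <= C * W * (H m * E m).
    apply: ler_pM => //; [by rewrite mulr_ge0|exact/ltW|].
    by rewrite ler_wpM2l.
  by lra.
have outer : W * (H kk ^+ 2 + C * N (4 * m).+1 * H kk.*2 + q kk (4 * m) ^+ 2)
    + q kk (4 * m) ^+ 2 <= (3 * B2 + C) * W ^+ 2 * (H m * E m).
  apply: (@le_trans _ _ (W * ((2 * B2 + C * W) * (H m * E m)) + B2 * (H m * E m))).
    by apply: lerD; [exact: ler_wpM2l|rewrite mulrA].
  rewrite mulrA -mulrDl ler_wpM2r //.
  have : B2 * W <= B2 * W ^+ 2 by rewrite ler_wpM2l // expr2 ler_peMl.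
  have : B2 <= B2 * W ^+ 2 by rewrite ler_peMr // expr2; nra.
  by nra.
apply: le_trans (ler_wpM2l N0 outer) _.
rewrite /D -/B2.
have -> : N n * ((3 * B2 + C) * W ^+ 2 * (H m * E m))
  = (3 * B2 + C) * (W ^+ 2 * (N n * H m * E m)) by ring.
rewrite -[leRHS]mulrA ler_wpM2l //; first by rewrite addr_ge0 // mulr_ge0.
have -> : (21 ^+ d) ^+ 2 * (m%:R ^+ (2 * d).+1 * E m)
  = (21 ^+ d * m%:R ^+ d) ^+ 2 * (m%:R * E m).
  by rewrite exprMn -!exprM exprSr (mulnC d 2); ring.
apply: ler_pM.
- by rewrite exprn_ge0.
- by rewrite !mulr_ge0 // ltW.
- by rewrite lerXn2r ?nnegrE // (le_trans W0).
- by rewrite ler_wpM2r.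
Unshelve. all: by end_near. Qed.

Lemma max_cluster_poisson_limit : V n (k (v n)) @[n --> \oo] --> expR (- l).
Proof.
pose r n := expR (- (q (k (v n)) (4 * v n) * N (n - (4 * v n).+1)%N)).
have rl : r n @[n --> \oo] --> expR (- l).
  apply: (cvg_comp _ _ (cvgN rate_cvg)); exact: continuous_expR.
pose err n := (v n)%:R ^+ 1 * E (v n) + 10 * d%:R * (l + 1) * z n
     + D * ((v n)%:R ^+ (2 * d).+1 * E (v n)).
have err0 : err n @[n --> \oo] --> (0 : R).
  have -> : (0 : R) = 0 + 10 * d%:R * (l + 1) * 0 + D * 0.
    by rewrite !mulr0 !addr0.
  apply: cvgD; first apply: cvgD.
  - exact: v_poly.
  - by apply: cvgMr; exact: scale_sq_cvg0.
  - by apply: cvgMr; exact: v_poly.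
have up : r n + err n @[n --> \oo] --> expR (- l).
  by rewrite -[X in _ --> X]addr0; exact: cvgD.
have low : r n - err n @[n --> \oo] --> expR (- l).
  by rewrite -[X in _ --> X]subr0; exact: cvgB.
apply: squeeze_cvgr low up; near=> n.
have : `|V n (k (v n)) - r n| <= err n by near: n; exact: error_bound.
by rewrite ler_norml => /andP[? ?]; apply/andP; split; lra.
Unshelve. all: by end_near. Qed.

End PoissonLimit.

(** * From percolation to the limit of real sequences *)

Lemma finite_cluster_ge_nat (R : realType) d k :
  finite_cluster_ge d (k%:R : R) = finite_event 0 k.
Proof.
by apply/seteqP; split=> w [fC kC]; split=> //; move: kC; rewrite ler_nat.
Qed.

Lemma measurable_finite_cluster_ge (R : realType) d (t : R) :
  measurable (finite_cluster_ge d t).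
Proof.
have -> : finite_cluster_ge d t
    = \bigcup_(k in [set k : nat | t <= k%:R]) finite_event 0 k.
  apply/seteqP; split=> [w [fC tC]|w [k /= tk [fC kC]]].
    by exists (card_fin (cluster w 0)).
  by split=> //; apply: le_trans tk _; rewrite ler_nat.
by apply: bigcup_measurable => k _; exact: measurable_finite_event.
Qed.

Theorem theorem1p2 (R : realType) (d : nat) (d_ge2 : (2 <= d)%N)
    (P : R -> probability (config d) R)
    (P_iid : forall q : R, 0 <= q <= 1 -> iid_bernoulli (P q) q)
    (pc : R) (pc_critical : critical_value P pc)
    (p : R) (p_range : pc < p < 1)
    (eta : R) (eta_gt0 : 0 < eta)
    (eta_lim :
      (- (n%:R `^ (- ((d%:R - 1) / d%:R))
          * ln (fine (P p (finite_cluster_ge d (n%:R : R)))))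
         @[n --> \oo] --> eta))
    (ratio_lim : forall x : R,
      (fine (P p (finite_cluster_ge d (n%:R + x * n%:R `^ (d%:R^-1))))
         / fine (P p (finite_cluster_ge d (n%:R : R)))
         @[n --> \oo] --> expR (- (x * eta * ((d%:R - 1) / d%:R))))) :
  exists u : nat -> R,
    (u n @[n --> \oo] --> +oo) /\
    forall x : R,
      fine (P p [set w | (max_finite_cluster n w)%:R
                           <= u n + x * u n `^ (d%:R^-1)])
        @[n --> \oo] --> expR (- expR (- (x * eta * ((d%:R - 1) / d%:R)))).
Proof.
have [pc01 _ _] := pc_critical.
have p01 : 0 < p < 1.
  by have /andP[pc0 _] := pc01; have /andP[pcp ->] := p_range;
    rewrite (lt_trans pc0 pcp).
have iid : iid_bernoulli (P p) p.
  by apply: P_iid; have /andP[p0 p1] := p01; rewrite !ltW.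
have d_gt0 : (0 < d)%N by exact: leq_trans d_ge2.
pose H (t : R) : R := prob (P p) (finite_cluster_ge d t).
have H_ge0 t : 0 <= H t by exact: prob_ge0.
have H_le1 t : H t <= 1 by apply: prob_le1; exact: measurable_finite_cluster_ge.
have H_anti s t : s <= t -> H t <= H s.
  move=> st; apply: prob_le; try exact: measurable_finite_cluster_ge.
  by move=> w [fC tC]; split=> //; exact: le_trans tC.
have H_nat k : H k%:R = prob (P p) (finite_event 0 k).
  by rewrite /H finite_cluster_ge_nat.
pose q k L := prob (P p) (endpoint_event 0 k L).
have q_ge0 k L : 0 <= q k L by exact: prob_ge0.
have q_upper k L : (0 < k)%N -> k%:R * q k L <= H k%:R.
  move=> k0; rewrite H_nat; apply: le_trans (prob_size_event_le iid 0 k L).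
  exact: (endpoint_mass_lower iid p01).
have q_lower k L L' : (0 < k)%N -> (k <= L'.+1)%N -> (L' <= L)%N ->
    H k%:R - H L'.+1%:R <= L'%:R * q k L.
  move=> k0 kL LL; rewrite !H_nat -(prob_size_eventE iid 0 kL).
  apply: le_trans (endpoint_mass_upper iid p01 L' k0) _.
  apply: ler_wpM2l => //; apply: prob_le; try exact: measurable_endpoint_event.
  by move=> w [fC CL hC]; split=> //; exact: leq_trans LL.
have H_gt0 := tail_gt0 eta_gt0 H_ge0 H_anti eta_lim.
have H_succ := tail_succ d_ge2 eta_gt0 H_ge0 H_anti eta_lim ratio_lim.
pose v := scale d H_le1.
have v_near Q : (\forall m \near \oo, Q m) -> \forall n \near \oo, Q (v n).
  exact: (near_scale d_gt0 H_gt0 H_le1 H_anti).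
exists (fun n => (v n)%:R); split.
  by apply/cvgryPge => A; exact: v_near (nbhs_infty_ger A).
move=> x; pose k := threshold d x.
have V_poisson n j L : (0 < j)%N -> (L < n)%N ->
    let N i := (i.*2.+1 ^ d)%N%:R : R in
    `|prob (P p) (max_lt n j) - expR (- (q j L * N (n - L.+1)%N))|
      <= N n * H L.+1%:R + (N n - N (n - L.+1)%N) * H j%:R
         + N n * (N (L.+1 + L.+1)%N * (H j%:R ^+ 2
             + bridge_cost d p * N L.+1 * H j.*2%:R
             + q j L ^+ 2) + q j L ^+ 2).
  by move=> j0 Ln /=; rewrite !H_nat; exact: max_lt_poisson.
have eighth : 0 < eta / 8 by rewrite divr_gt0.
have eps8 : 0 < (8^-1 : R) by rewrite invr_gt0.
(* Two clusters of size at least [7/8 * m] merge into one of size at least [7/4 * m], the ratio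
   handled by [tail_ratio_small]. *)
have k_near : \forall m \near \oo, 7 / 8 * m%:R <= (k m)%:R :> R.
  apply: filterS (threshold_near d_ge2 x eps8) => m [_ h _].
  by apply: le_trans h; lra.
have k_base : \forall m \near \oo, 0 <= m%:R + x * m%:R `^ d%:R^-1 :> R.
  by apply: filterS (threshold_near d_ge2 x eps8) => m [].
have limit := @max_cluster_poisson_limit R d d_gt0 (fun m => H m%:R)
  (fun m => expR (- (eta / 8 * m%:R `^ ((d%:R - 1) / d%:R)))) q
  (fun n j => prob (P p) (max_lt n j)) v k (bridge_cost d p) _
  (fun m => H_gt0 m%:R) (fun m => expR_ge0 _) q_ge0 q_upper
  (bridge_cost_ge0 p01) (expR_gt0 (- (x * eta * ((d%:R - 1) / d%:R))))
  V_poisson (fun=> isT) v_near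
  (scale_upper d H_le1) (scale_volume d_gt0 H_gt0 H_le1 H_anti H_succ)
  (fun i => cvg_comp _ _ (scale_cvg d_gt0 H_gt0 H_le1 H_anti)
     (poly_expR_cvg0 i eighth (near_M_ge d_ge2) (near_M_sq d_ge2)))
  (tail_small eta_gt0 H_ge0 H_anti eta_lim)
  (tail_ratio_small d_ge2 eta_gt0 H_ge0 H_anti eta_lim)
  (fun=> isT) k_near
  (tail_threshold d_ge2 eta_gt0 H_ge0 H_anti eta_lim ratio_lim (x := x))
  (endpoint_threshold d_ge2 eta_gt0 H_ge0 H_anti eta_lim ratio_lim
     q_ge0 q_upper q_lower (x := x)).
apply: cvg_trans limit; apply: near_eq_cvg; near=> n.
have t0 : 0 <= (v n)%:R + x * (v n)%:R `^ d%:R^-1.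
  by near: n; exact: v_near k_base.
(* As [t0] makes the real bound nonnegative, being at most this bound is being below the integer
   threshold. *)
congr (fine (P p _)); apply/seteqP; split=> w /=.
  by rewrite /max_lt /= ltnS truncn_ge_nat.
by rewrite /max_lt /= ltnS truncn_ge_nat.
Unshelve. all: by end_near. Qed.
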